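(* Let $M$ be a Riemann surface. Sending a Weierstrass representation $(\omega,\eta)$ of $M$ to the spinor representation $(S=\eta^*(\mathcal{O}_{\mathbb{C}P^1}(-1)),\sqrt{\omega},\eta)$ gives a one-to-one correspondence between the set of Weierstrass representations of $M$ and the set of equivalence classes of spinor representations of $M$. Under this correspondence, holomorphic Weierstrass representations correspond precisely to equivalence classes of holomorphic spinor representations.
   Context: All bundles and maps are smooth unless stated otherwise. $Q=\{w\in\mathbb{C}^3:w_1^2+w_2^2+w_3^2=0\}$, $[Q]\subset\mathbb{C}P^2$ is its projectivization, and $\mathcal{O}_{[Q]}(-1)\subset[Q]\times\mathbb{C}^3$, $\mathcal{O}_{\mathbb{C}P^1}(-1)\subset\mathbb{C}P^1\times\mathbb{C}^2$ are the tautological line bundles. The map $\theta(z_0,z_1)=(z_0^2-z_1^2,\,i(z_0^2+z_1^2),\,2z_0z_1)$ induces a biholomorphism $\tilde\theta\colon\mathbb{C}P^1\to[Q]$ and a holomorphic fiberwise complex-quadratic surjective bundle map $\gamma\colon\mathcal{O}_{\mathbb{C}P^1}(-1)\to\mathcal{O}_{[Q]}(-1)$ covering $\tilde\theta$, i.e. an isomorphism $\mathcal{O}_{\mathbb{C}P^1}(-2)\cong\mathcal{O}_{[Q]}(-1)$. Via $\mathcal{O}_{\mathbb{C}P^1}(-2)\cong T^*\mathbb{C}P^1$, the bundle $\mathcal{O}_{[Q]}(-1)\to[Q]$ is identified with $T^*\mathbb{C}P^1\to\mathbb{C}P^1$, and $\gamma$ makes $\mathcal{O}_{\mathbb{C}P^1}(-1)$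 a square root of $T^*\mathbb{C}P^1$. A Weierstrass representation of $M$ is a nowhere vanishing $\mathbb{C}^3$-valued $(1,0)$-form $\omega=(\omega_1,\omega_2,\omega_3)$ on $M$ with $\omega_1^2+\omega_2^2+\omega_3^2=0$; equivalently, a $\mathbb{C}$-linear fiberwise isomorphic bundle map $(\omega,\eta)$ from $TM\to M$ to $\mathcal{O}_{[Q]}(-1)\to[Q]$ (with $\eta(p)=\omega(T_pM)$), equivalently to $T^*\mathbb{C}P^1\to\mathbb{C}P^1$. It is holomorphic if $\omega$ is a holomorphic form (equivalently, if the bundle map is holomorphic). A square root of $TM$ is a complex line bundle $S$ over $M$ with a surjective bundle map $S\to TM$ over $M$, complex-quadratic on each fiber; an equivalence of square roots is an isomorphism of complex line bundles commuting with the maps to $TM$. Every square root $S$ of $TM$ has a unique holomorphic structure making $S\to TM$ holomorphic. A spinor representation of $M$ is a triple $(S,\beta,\eta)$ where $S$ is a square root of $TM$ and $(\beta,\eta)$ is a $\mathbb{C}$-linear fiberwise isomorphic bundle map from $S\to M$ to $\mathcal{O}_{\mathbb{C}P^1}(-1)\to\mathbb{C}P^1$. Two spinor representations $(S_1,\beta_1,\eta_1)$, $(S_2,\beta_2,\eta_2)$ are equivalent if there is an equivalence $\alpha\colon S_1\to S_2$ of square roots of $TM$ with $\beta_2\circ\alpha=\beta_1$. A spinor representation is holomorphic if $\beta$ is holomorphic (with respect to the unique holomorphic structure on $S$ making the quadratic map $S\to TM$ holomorphic). Given a Weierstrass representation $(\omega,\eta)$, viewed as a bundle map to $T^*\mathbb{C}P^1\to\mathbb{C}P^1$,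 $\omega$ gives an isomorphism $TM\cong\eta^*(T^*\mathbb{C}P^1)$. Then $S=\eta^*(\mathcal{O}_{\mathbb{C}P^1}(-1))$, with the pulled-back quadratic map to $\eta^*(T^*\mathbb{C}P^1)\cong TM$, is a square root of $TM$, and $\sqrt{\omega}\colon S\to\mathcal{O}_{\mathbb{C}P^1}(-1)$ is the canonical bundle map covering $\eta$. *)

(* Defs.v *)
From HB Require Import structures.
From mathcomp Require Import all_boot all_order all_algebra.
From mathcomp Require Import all_classical all_reals all_analysis.
From mathcomp Require Import complex.

Set Implicit Arguments.
Unset Strict Implicit.
Unset Printing Implicit Defensive.

Import Order.TTheory GRing.Theory Num.Theory.
Import numFieldNormedType.Exports.

Local Open Scope classical_set_scope.
Local Open Scope ring_scope.

(** * Smooth and holomorphic functions between complex normed spaces *)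

Section Regularity.
Variables (R : realType) (V W : normedModType R[i]).
Implicit Types (U : set V) (f : V -> W) (x : V).

(* The library's [differentiable] over the field [R[i]] is complex
   differentiability; here the differential is only required to be linear over
   the reals, which embed in R[i] as the elements t%:C. *)
Definition is_real_diff f x (L : V -> W) : Prop :=
  [/\ forall u v, L (u + v) = L u + L v,
      forall (t : R) u, L (t%:C%C *: u) = t%:C%C *: L u,
      continuous L &
      f \o shift x = cst (f x) + L +o_ (0 : V) id].

(* f is of class C^k on U.  The derivative is controlled one direction at a
   time, which is the usual notion because all model spaces below are
   finite-dimensional. *)
Fixpoint Ck (k : nat) U f : Prop :=
  if k is k'.+1 then
    exists L : V -> V -> W,
      (forall x, U x -> is_real_diff f x (L x)) /\
      (forall v, Ck k' U (fun x => L x v))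
  else forall x, U x -> {for x, continuous f}.

Definition smooth_on U f : Prop := forall k, Ck k U f.

(* A holomorphic function is a smooth function with complex-linear
   differentials. *)
Definition holomorphic_on U f : Prop :=
  smooth_on U f /\ forall x, U x -> differentiable f x.

End Regularity.

Variant regularity := Smooth | Holomorphic.

Definition regular_on (R : realType) (V W : normedModType R[i])
    (r : regularity) (U : set V) (f : V -> W) : Prop :=
  match r with
  | Smooth => smooth_on U f
  | Holomorphic => holomorphic_on U f
  end.

(** * Spaces with charts *)

Record chart (X V : Type) := Chart { cdom : set X; cmap : X -> V }.

(* A set with a family of charts; the compatibility conditions are in
   [is_manifold].  The topology is the one induced by the charts. *)
Record charted (V : Type) := Charted {
  point :> Type;
  cidx : Type;
  cchart : cidx -> chart point V }.

Section Manifolds.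
Variable R : realType.

(* Every coordinate expression of f is defined on an open set (so that f is
   continuous) and is regular there.  The coordinate expression is given by
   the function g, whose values off the set under consideration are
   irrelevant. *)
Definition regular_map (V W : normedModType R[i]) (r : regularity)
    (X : charted V) (Y : charted W) (f : X -> Y) : Prop :=
  forall (i : cidx X) (j : cidx Y),
    let phi := cmap (cchart i) in
    let psi := cmap (cchart j) in
    let D := cdom (cchart i) `&` f @^-1` cdom (cchart j) in
    open (phi @` D) /\
    exists g : V -> W, regular_on r (phi @` D) g /\
      forall x, D x -> g (phi x) = psi (f x).

(* The last clause says that the charts have open images and that the
   transition functions have open domains and are regular. *)
Definition is_manifold (V : normedModType R[i]) (r : regularity)
    (X : charted V) : Prop :=
  [/\ forall x : X, exists i, cdom (cchart (c := X) i) x,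
      forall i : cidx X,
        {in cdom (cchart i) &, injective (cmap (cchart i))} &
      regular_map r (X := X) (Y := X) id].

(* A normed space as a manifold, with a single global chart. *)
Definition affine_space (V : normedModType R[i]) : charted V :=
  @Charted V V unit (fun=> Chart setT id).

(* Connectedness is not required. *)
Record riemann_surface := RiemannSurface {
  rs_space :> topologicalType;
  rs_idx : Type;
  rs_chart : rs_idx -> chart rs_space R[i]^o;
  rs_hausdorff : hausdorff_space rs_space;
  rs_countable : @second_countable rs_space;
  rs_open : forall i, open (cdom (rs_chart i));
  rs_continuous : forall i x, cdom (rs_chart i) x ->
    {for x, continuous (cmap (rs_chart i))};
  rs_open_map : forall i (U : set rs_space), open U ->
    U `<=` cdom (rs_chart i) -> open (cmap (rs_chart i) @` U);
  rs_atlas : is_manifold Holomorphic (Charted rs_chart) }.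

Definition rs_charted (M : riemann_surface) : charted R[i]^o :=
  Charted (@rs_chart M).

End Manifolds.

(** * Complex line bundles *)

(* Local trivializations of proj : E -> B are given by their fibre coordinates:
   the j-th trivialization is e |-> (proj e, tcoord j e) over tdom j. *)
Record trivs (C B E : Type) := Trivs {
  tidx : Type;
  tdom : tidx -> set B;
  tcoord : tidx -> E -> C }.

Arguments tdom {C B E} t j.
Arguments tcoord {C B E} t j.

Record lbundle (C B : Type) := LBundle {
  total : Type;
  proj : total -> B;
  ltriv : trivs C B total }.

Definition retriv (C B : Type) (E : lbundle C B) (T : trivs C B (total E)) :
    lbundle C B := LBundle (proj (l := E)) T.

Section LineBundles.
Variables (R : realType) (V : normedModType R[i]).
Local Notation C := (R[i]^o).

Definition total_space (X : charted V) (E : lbundle C X) :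
    charted (V * C)%type :=
  @Charted (V * C)%type (total E) (cidx X * tidx (ltriv E))%type
    (fun ij => Chart
      [set e | cdom (cchart ij.1) (proj e) /\ tdom (ltriv E) ij.2 (proj e)]
      (fun e => (cmap (cchart ij.1) (proj e), tcoord (ltriv E) ij.2 e))).

(* On the fibre over p the map f is z |-> a * z ^+ d in trivializations, for
   some nonzero a.  The vector space structure of a fibre is the one which
   makes the fibre coordinates linear; as fibres have dimension one, d = 1
   means a linear isomorphism onto the target fibre, and d = 2 a nonzero
   (equivalently, surjective) complex-quadratic map. *)
Definition fiber_homogeneous (d : nat) (B B' : Type) (E : lbundle C B)
    (E' : lbundle C B') (h : B -> B') (f : total E -> total E') : Prop :=
  forall p i j, tdom (ltriv E) i p -> tdom (ltriv E') j (h p) ->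
    exists a : C, a != 0 /\
      forall e, proj e = p ->
        tcoord (ltriv E') j (f e) = a * tcoord (ltriv E) i e ^+ d.

(* The transition functions are fibrewise linear, and regular jointly in the
   base point and the fibre coordinate. *)
Definition is_lbundle (r : regularity) (X : charted V) (E : lbundle C X) :
    Prop :=
  [/\ forall p : X, exists j, tdom (ltriv E) j p,
      forall j p, tdom (ltriv E) j p -> forall z : C,
        exists! e, proj (l := E) e = p /\ tcoord (ltriv E) j e = z,
      fiber_homogeneous 1 (E := E) (E' := E) id id &
      is_manifold r (total_space E)].

Definition is_lbundle_iso (r : regularity) (X : charted V)
    (E E' : lbundle C X) (f : total E -> total E') : Prop :=
  [/\ forall e, proj (f e) = proj e,
      fiber_homogeneous 1 (E := E) (E' := E') id f,
      regular_map r (X := total_space E) (Y := total_space E') f &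
      exists g : total E' -> total E,
        [/\ cancel f g, cancel g f &
            regular_map r (X := total_space E') (Y := total_space E) g]].

End LineBundles.

Definition pullback (C B B' : Type) (h : B -> B') (E : lbundle C B') :
    lbundle C B :=
  @LBundle C B {x : B * total E | h x.1 = proj x.2} (fun x => (sval x).1)
    (@Trivs C B _ (tidx (ltriv E)) (fun j => h @^-1` tdom (ltriv E) j)
       (fun j x => tcoord (ltriv E) j (sval x).2)).

(** * The tangent bundle of a Riemann surface *)

Section TangentBundle.
Variables (R : realType) (M : riemann_surface R).
Local Notation C := (R[i]^o).
Local Notation phi i := (cmap (rs_chart (r := M) i)).
Local Notation dom i := (cdom (rs_chart (r := M) i)).

(* A tangent vector at p is given by its components in all charts around p,
   related by the derivatives of the transition functions.  The components in
   the other charts are set to 0, so that equality of tangent vectors is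
   Leibniz equality. *)
Definition is_tangent (p : M) (v : rs_idx M -> C) : Prop :=
  (forall i, ~ dom i p -> v i = 0) /\
  (forall i j, dom i p -> dom j p -> forall g : C -> C,
     (forall x, dom i x -> dom j x -> g (phi i x) = phi j x) ->
     v j = derive1 g (phi i p) * v i).

Definition tangent := {x : M * (rs_idx M -> C) | is_tangent x.1 x.2}.

Definition TM : lbundle C (rs_charted M) :=
  @LBundle C M tangent (fun x => (sval x).1)
    (@Trivs C M tangent (rs_idx M) (fun i => dom i)
       (fun i x => (sval x).2 i)).

Lemma zero_is_tangent (p : M) : is_tangent p (fun=> 0).
Proof. by split=> // i j _ _ g _; rewrite mulr0. Qed.

Definition zero_tangent (p : M) : total TM :=
  exist _ (p, fun=> 0) (zero_is_tangent p).

End TangentBundle.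

(** * The projective line and its tautological bundle *)

Section ProjectiveLine.
Variable R : realType.
Local Notation C := (R[i]^o).

Definition CP1 := {L : {vspace 'rV[R[i]]_2} | \dim L == 1%N}.

(* The affine chart [v] |-> v_(1-k) / v_k. *)
Definition CP1_charted : charted C :=
  @Charted C CP1 'I_2
    (fun k => Chart [set L : CP1 | vpick (sval L) 0 k != 0]
       (fun L : CP1 =>
          vpick (sval L) 0 (rev_ord k) / vpick (sval L) 0 k)).

(* O(-1), with the fibre coordinate v |-> v_k where the k-th homogeneous
   coordinate does not vanish. *)
Definition taut_total := {e : CP1 * 'rV[R[i]]_2 | e.2 \in sval e.1}.

Definition taut_vec (e : taut_total) : 'rV[R[i]]_2 := (sval e).2.

Definition taut : lbundle C CP1_charted :=
  @LBundle C CP1 taut_total (fun e => (sval e).1)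
    (@Trivs C CP1 taut_total 'I_2
       (fun k => cdom (cchart (c := CP1_charted) k))
       (fun k e => taut_vec e 0 k)).

Lemma line0_dim : \dim <[delta_mx ord0 ord0 : 'rV[R[i]]_2]>%VS == 1%N.
Proof.
rewrite dim_vline; suff -> : (delta_mx ord0 ord0 : 'rV[R[i]]_2) != 0 by [].
by apply/eqP => /matrixP/(_ ord0 ord0)/eqP; rewrite !mxE /= oner_eq0.
Qed.

Definition CP1_line0 : CP1 :=
  exist (fun L : {vspace 'rV[R[i]]_2} => \dim L == 1%N) _ line0_dim.

Definition theta (z : 'rV[R[i]]_2) : 'rV[R[i]]_3 :=
  \row_(k < 3) [:: z 0 0 ^+ 2 - z 0 1 ^+ 2;
                   'i * (z 0 0 ^+ 2 + z 0 1 ^+ 2);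
                   2 * z 0 0 * z 0 1]`_k.

End ProjectiveLine.

(** * Weierstrass and spinor representations *)

Section Representations.
Variables (R : realType) (M : riemann_surface R).
Local Notation C := (R[i]^o).
Local Notation M' := (rs_charted M).
Local Notation TM := (TM M).
Local Notation taut := (taut R).

Definition vform := total TM -> 'rV[R[i]]_3.

(* A (1,0)-form is a smooth function on the tangent bundle which is
   complex-linear on each fibre. *)
Definition form10 (r : regularity) (w : vform) : Prop :=
  (forall p i, tdom (ltriv TM) i p ->
     exists u : 'rV[R[i]]_3,
       forall X, proj X = p -> w X = (tcoord (ltriv TM) i X : R[i]) *: u) /\
  regular_map r (X := total_space TM) (Y := affine_space 'rV[R[i]]_3) w.

Definition weierstrass : set vform :=
  [set w | [/\ form10 Smooth w,
     forall p : M, exists X, proj X = p /\ w X != 0 &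
     forall X, \sum_(k < 3) w X 0 k ^+ 2 = 0]].

Definition holomorphic_weierstrass : set vform :=
  [set w | weierstrass w /\ form10 Holomorphic w].

(* The map p |-> [w (T_p M)] to [Q], read in CP^1: the line L of C^2 such that
   theta maps L onto the line w (T_p M) of Q. *)
Definition gauss_map (w : vform) (p : M') : CP1_charted R :=
  xget (CP1_line0 R)
    [set L : CP1 R | @theta R @` [set v | v \in sval L] =
                     w @` [set X | proj X = p]].

Definition is_square_root (S : lbundle C M') (q : total S -> total TM) :
    Prop :=
  [/\ is_lbundle Smooth S,
      forall s, proj (q s) = proj s,
      fiber_homogeneous 2 (E := S) (E' := TM) id q,
      forall X, exists s, q s = X &
      regular_map Smooth (X := total_space S) (Y := total_space TM) q].

Record spinor_data := SpinorData {
  sp_bundle : lbundle C M';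
  sp_square : total sp_bundle -> total TM;
  sp_beta : total sp_bundle -> total taut;
  sp_eta : M' -> CP1_charted R }.

Arguments sp_square : clear implicits.
Arguments sp_beta : clear implicits.

(* Spinor data form a large type, for which the library's [set] is not
   available. *)
Definition spinor (s : spinor_data) : Prop :=
  [/\ is_square_root (sp_square s),
     regular_map Smooth (sp_eta s),
     regular_map Smooth (X := total_space (sp_bundle s))
       (Y := total_space taut) (sp_beta s),
     forall e, proj (sp_beta s e) = sp_eta s (proj e) &
     fiber_homogeneous 1 (E := sp_bundle s) (E' := taut)
       (sp_eta s) (sp_beta s)].

(* T is a holomorphic structure on S refining its structure of smooth complex
   line bundle. *)
Definition holomorphic_structure (S : lbundle C M')
    (T : trivs C M' (total S)) : Prop :=
  is_lbundle Holomorphic (retriv T) /\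
  is_lbundle_iso Smooth (E := S) (E' := retriv T) id.

(* The holomorphic structure T making the square map holomorphic is unique up
   to equivalence of holomorphic structures. *)
Definition holomorphic_spinor (s : spinor_data) : Prop :=
  spinor s /\
  exists T : trivs C M' (total (sp_bundle s)),
    [/\ holomorphic_structure T,
        regular_map Holomorphic (X := total_space (retriv T))
          (Y := total_space TM) (sp_square s) &
        regular_map Holomorphic (X := total_space (retriv T))
          (Y := total_space taut) (sp_beta s)].

Definition spinor_equiv (s1 s2 : spinor_data) : Prop :=
  exists alpha : total (sp_bundle s1) -> total (sp_bundle s2),
    [/\ is_lbundle_iso Smooth (E := sp_bundle s1) (E' := sp_bundle s2) alpha,
        forall e, sp_square s2 (alpha e) = sp_square s1 e &
        forall e, sp_beta s2 (alpha e) = sp_beta s1 e].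

(* S = eta^* O(-1) and beta is the canonical map to O(-1).  The square map
   sends (p, v) to the tangent vector X at p with w X = theta v: this is the
   pulled-back quadratic map followed by the isomorphism
   eta^* (T^* CP^1) = eta^* O_[Q](-1) = TM given by w. *)
Definition sqrt_square (w : vform)
    (s : total (pullback (gauss_map w) taut)) : total TM :=
  xget (zero_tangent (proj s) : {classic total TM})
    [set X : total TM |
       proj X = proj s /\ w X = theta (taut_vec (sval s).2)].

Definition spinor_of_weierstrass (w : vform) : spinor_data :=
  SpinorData (sp_bundle := pullback (gauss_map w) taut)
    (@sqrt_square w) (fun s => (sval s).2) (gauss_map w).

End Representations.

(* Main.v *)
(* Let theta : C^2 -> Q be the double cover.  For a square root q : S -> TM and
   beta : S -> O(-1), the form attached to the spinor is the w such that
   w (q e) = theta (beta e); it is well defined because q e determines e up to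
   sign and theta is even.  Conversely theta is injective up to sign and onto the
   quadric, so w determines eta, and a spinor is determined up to equivalence by
   its form: points of two bundles are matched when they have the same image
   under beta, and such a bijection is automatically a smooth isomorphism.

   For regularity, a map of line bundles reads z |-> a(p) z ^ d in
   trivializations and is regular exactly when its base map and its coefficients
   a are.  If beta has coefficient b and q has coefficient a, then w has
   coefficient (b ^ 2 / a) theta(1, t), where t is the coordinate of eta;
   conversely t and the coefficient of q are rational in w, since v_k ^ 2 and
   v_0 v_1 are linear in theta(v).  So no branch of the square root has to be
   chosen, and, reading w in every pair of charts of TM, the holomorphic case does
   not use that derivatives of transition functions of M are holomorphic.  The
   holomorphic structure on S is the one whose fibre coordinates are the
   components of beta. *)

From HB Require Import structures.
From Pilot Require Import Defs.
From mathcomp Require Import all_boot all_order all_algebra.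
From mathcomp Require Import all_classical all_reals all_analysis.
From mathcomp Require Import complex ring.

Set Implicit Arguments.
Unset Strict Implicit.
Unset Printing Implicit Defensive.

Import Pilot.Defs.
Import Order.TTheory GRing.Theory Num.Theory.
Import numFieldNormedType.Exports.

Local Open Scope classical_set_scope.
Local Open Scope ring_scope.

(** * Real differentials *)

Section RealDerivative.
Variable R : realType.
Local Notation K := R[i].

(** Norms take values in [R[i]], while differentials commute only with real scalars. This turns a
    positive bound into a scalar that may be pulled through them. *)
Lemma pos_complexP (e : K) : 0 < e -> exists2 t : R, 0 < t & e = t%:C%C.
Proof.
move=> e0; have /complex_realP[t et] : e \is Num.real by apply: gtr0_real.
by exists t => //; rewrite -ltcR -et.
Qed.

Lemma near_interior (V : topologicalType) (x : V) (P : V -> Prop) :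
  (\forall y \near x, P y) -> \forall y \near x, \forall z \near y, P z.
Proof. exact: nbhs_interior. Qed.

Section Uniqueness.
Variables V W : normedModType K.
Implicit Types (f : V -> W) (x : V) (L : V -> W).

Definition real_linear L :=
  (forall u v, L (u + v) = L u + L v) /\
  (forall (t : R) u, L (t%:C%C *: u) = t%:C%C *: L u).

Lemma real_linear0 L : real_linear L -> L 0 = 0.
Proof.
have C0 : (0 : R)%:C%C = 0 :> K by exact: rmorph0.
by case=> _ /(_ 0 0); rewrite C0 !scale0r.
Qed.

Lemma real_linearN L u : real_linear L -> L (- u) = - L u.
Proof.
have N1 : (-1 : R)%:C%C = -1 :> K by exact: (rmorphN1 (real_complex R)).
by case=> _ /(_ (-1) u); rewrite N1 !scaleN1r.
Qed.

Lemma real_linearB L u v : real_linear L -> L (u - v) = L u - L v.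
Proof. by move=> hL; rewrite (proj1 hL) real_linearN. Qed.

Lemma is_real_diffP f x L : is_real_diff f x L <->
  [/\ real_linear L, continuous L &
      forall e : K, 0 < e ->
        \forall h \near (0 : V), `|f (h + x) - f x - L h| <= e * `|h|].
Proof.
have H : f \o shift x = cst (f x) + L +o_ (0 : V) id <-> forall e : K, 0 < e ->
        \forall h \near (0 : V), `|f (h + x) - f x - L h| <= e * `|h|.
  apply: iff_trans; first exact: eqaddoP.
  by split=> hf e e0; have := hf e e0; apply: filterS => h /=;
    rewrite -[X in _ \o X]/( _ ) /= !fctE opprD addrA.
by split; [move=> [h1 h2 h3 /H h4] | move=> [[h1 h2] h3 /H h4]].
Qed.

(* Rescale by small positive reals. *)
Lemma real_linear_le_near L (c : K) : real_linear L ->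
  (\forall h \near (0 : V), `|L h| <= c * `|h|) -> forall h, `|L h| <= c * `|h|.
Proof.
move=> hL hc h.
have cvg0 : (fun t : K^o => t *: h) @ (0 : K^o) --> (0 : V).
  by have c0 := @scalel_continuous _ V h (0 : K); rewrite -[X in _ --> X](scale0r h); exact: c0.
have /nbhs_normP[e /= e0 he] : \forall t \near (0 : K^o), `|L (t *: h)| <= c * `|t *: h|.
  exact: cvg0 hc.
have [t t0 et] := pos_complexP e0.
have t20 : 0 < (t / 2)%:C%C :> K by rewrite ltcR divr_gt0.
have := he (t / 2)%:C%C; rewrite /ball_ /= sub0r normrN et gtr0_norm //.
rewrite ltcR ltr_pdivrMr // ltr_pMr // ltr1n => /(_ isT).
rewrite (proj2 hL) !normrZ gtr0_norm // mulrCA ler_pM2l //.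
Qed.

Lemma real_linear_eq0 L : real_linear L ->
  (forall e : K, 0 < e -> \forall h \near (0 : V), `|L h| <= e * `|h|) -> forall h, L h = 0.
Proof.
move=> hL he h; apply/eqP; rewrite -normr_le0.
have [->|h0] := eqVneq h 0; first by rewrite real_linear0 // normr0.
rewrite -[_ <= _]negbK; apply/negP => hn.
have Lh0 : 0 < `|L h|.
  by rewrite normr_gt0; apply: contra hn => /eqP ->; rewrite normr0.
have h0' : 0 < `|h| by rewrite normr_gt0.
(* With this constant the global bound at h reads |L h| <= |L h| / 2. *)
have e0 : 0 < `|L h| / `|h| / 2 by rewrite !divr_gt0.
have := real_linear_le_near hL (he _ e0) h.
by rewrite mulrAC divfK ?gt_eqF // ler_pdivlMr // ger_pMr // (ler_nat _ 2 1).
Qed.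

(** Continuity at 0 gives a ball of radius e on which |L| < 1. Rescaling h by a real factor to norm
    e / 2 yields the constant [(e / 2)^-1]. *)
Lemma real_linear_bounded L : real_linear L -> continuous L ->
  exists2 c : K, 0 < c & forall h, `|L h| <= c * `|h|.
Proof.
move=> hL cL.
have : \forall h \near (0 : V), `|L h| < 1.
  have cL0 : L @ (0 : V) --> (0 : W).
    by rewrite -[X in _ --> X](real_linear0 hL); exact: cL.
  by move/cvgr0Pnorm_lt: cL0 => /(_ 1 ltr01).
move=> /nbhs_normP[e /= e0 he]; have [t t0 et] := pos_complexP e0.
exists (e / 2)^-1 => [|h]; first by rewrite invr_gt0 divr_gt0.
have [->|h0] := eqVneq h 0; first by rewrite real_linear0 // !normr0 mulr0.
have h0' : 0 < `|h| by rewrite normr_gt0.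
have s0 : 0 < e / 2 / `|h| by rewrite !divr_gt0.
have [s s0' es] := pos_complexP s0.
have := he (s%:C%C *: h); rewrite /ball_ /= sub0r normrN normrZ -es gtr0_norm //.
rewrite divfK ?gt_eqF // ltr_pdivrMr // ltr_pMr // (ltr_nat _ 1 2) => /(_ isT).
rewrite es (proj2 hL) normrZ -es gtr0_norm // => /ltW.
by rewrite mulrAC ler_pdivrMr // mul1r ler_pdivlMl ?divr_gt0.
Qed.

(** The difference of two differentials is real-linear and o(h), hence zero by [real_linear_eq0]. *)
Lemma is_real_diff_unique f x L1 L2 :
  is_real_diff f x L1 -> is_real_diff f x L2 -> L1 = L2.
Proof.
move=> /is_real_diffP[l1 _ h1] /is_real_diffP[l2 _ h2].
apply/funext => h; apply/eqP; rewrite -subr_eq0; apply/eqP.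
apply: (@real_linear_eq0 (fun h => L1 h - L2 h)) => [|e e0].
  split=> [u v|t u]; first by rewrite (proj1 l1) (proj1 l2) opprD addrACA.
  by rewrite (proj2 l1) (proj2 l2) scalerBr.
have e20 : 0 < e / 2 by rewrite divr_gt0.
move: (h1 _ e20) (h2 _ e20); apply: filterS2 => k k1 k2.
rewrite (_ : L1 k - L2 k =
  (f (k + x) - f x - L2 k) - (f (k + x) - f x - L1 k)); last first.
  by rewrite opprB [RHS]addrC addrA subrK.
apply: (le_trans (ler_normB _ _)); apply: (le_trans (lerD k2 k1)).
by rewrite -mulrDl -splitr.
Qed.

Lemma is_real_diff_lip f x L : is_real_diff f x L ->
  exists2 c : K, 0 < c & \forall h \near (0 : V), `|f (h + x) - f x| <= c * `|h|.
Proof.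
move=> /is_real_diffP[hL cL hf]; have [c c0 hc] := real_linear_bounded hL cL.
exists (1 + c); first by rewrite addr_gt0.
move: (hf 1 ltr01); apply: filterS => h; rewrite -(lerD2r `|L h|) => h1.
rewrite -[X in `|X|](subrK (L h)); apply: (le_trans (ler_normD _ _)).
by apply: (le_trans h1); rewrite mulrDl lerD2l.
Qed.

Lemma lip_cvg0 f x (c : K) : 0 < c ->
  (\forall h \near (0 : V), `|f (h + x) - f x| <= c * `|h|) ->
  (fun h => f (h + x) - f x) @ (0 : V) --> (0 : W).
Proof.
move=> c0 hf; apply/cvgr0Pnorm_lt => e e0.
have ec0 : 0 < e / c by rewrite divr_gt0.
move: hf (@nbhs0_lt _ V _ ec0); apply: filterS2 => h h1 h2.
by apply: (le_lt_trans h1); rewrite mulrC -ltr_pdivlMr.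
Qed.

Lemma is_real_diff_continuous f x L : is_real_diff f x L -> {for x, continuous f}.
Proof.
move=> /is_real_diff_lip[c c0 /(lip_cvg0 c0) hf].
apply/cvgrPdist_lt => e e0; rewrite [\forall y \near _, _ < _](near_shift 0) subr0.
move/cvgr0Pnorm_lt: hf => /(_ _ e0); apply: filterS => h /=.
by rewrite distrC.
Qed.

Lemma is_real_diff_near f g x L : (\forall y \near x, f y = g y) ->
  is_real_diff f x L -> is_real_diff g x L.
Proof.
move=> fg /is_real_diffP[hL cL hf]; apply/is_real_diffP; split=> // e e0.
move: fg (hf e e0); rewrite [\forall y \near x, _ = _](near_shift 0) subr0 => fg.
have := nbhs_singleton fg; rewrite /= add0r => fgx.
by move: fg; apply: filterS2 => h /= <-; rewrite fgx.
Qed.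

End Uniqueness.

(** * Chain rule and calculus of real differentials *)

Lemma is_real_diff_comp (U V W : normedModType K) (f : U -> V) (g : V -> W) x Lf Lg :
  is_real_diff f x Lf -> is_real_diff g (f x) Lg ->
  is_real_diff (g \o f) x (Lg \o Lf).
Proof.
move=> df dg; have [c c0 hc] := is_real_diff_lip df.
move/is_real_diffP: df => [lf cf hf]; move/is_real_diffP: dg => [lg cg hg].
have [d d0 hd] := real_linear_bounded lg cg.
apply/is_real_diffP; split=> [||e e0].
- split=> [u v|t u] /=; first by rewrite (proj1 lf) (proj1 lg).
  by rewrite (proj2 lf) (proj2 lg).
- by move=> y; apply: continuous_comp; [exact: cf|exact: cg].
(* The error splits into the remainder of g at k = f (h + x) - f x and [Lg] applied to the remainder
   of f. Here [e1] absorbs the local Lipschitz constant c of f and [e2] the bound d of [Lg], so each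
   part contributes e / 2. *)
have e1 : 0 < e / 2 / c by rewrite !divr_gt0.
have e2 : 0 < e / 2 / d by rewrite !divr_gt0.
have hg' : \forall h \near (0 : U), `|g (f (h + x) - f x + f x) - g (f x)
    - Lg (f (h + x) - f x)| <= e / 2 / c * `|f (h + x) - f x|.
  exact: lip_cvg0 c0 hc _ (hg _ e1).
move: hg' hc (hf _ e2); apply: filterS3 => h /=; rewrite subrK => g1 h1 h2.
set k := f (h + x) - f x in g1 h1 h2.
rewrite (_ : _ - Lg (Lf h) = (g (f (h + x)) - g (f x) - Lg k) + Lg (k - Lf h)); last first.
  by rewrite (real_linearB k (Lf h) lg) addrA subrK.
apply: (le_trans (ler_normD _ _)); rewrite [e]splitr mulrDl lerD //.
  by apply: (le_trans g1); rewrite -(@ler_pM2l _ (e / 2 / c)) // in h1; rewrite mulrA divfK ?gt_eqF // in h1.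
apply: (le_trans (hd _)); rewrite -ler_pdivlMl // mulrA [_^-1 * _]mulrC.
exact: h2.
Qed.

Lemma is_real_diff_linear (V W : normedModType K) (L : {linear V -> W}) x :
  continuous L -> is_real_diff L x L.
Proof.
move=> cL; apply/is_real_diffP; split=> // [|e e0].
  by split=> [u v|t u]; rewrite ?linearD ?linearZ.
by apply: nearW => h; rewrite linearD addrK subrr normr0 mulr_ge0 // ltW.
Qed.

Lemma is_real_diff_cst (V W : normedModType K) (c : W) (x : V) :
  is_real_diff (cst c) x (fun=> 0).
Proof.
apply/is_real_diffP; split=> // [|x' |e e0].
- by split=> *; rewrite ?addr0 ?scaler0.
- exact: cvg_cst.
by apply: nearW => h; rewrite !subrr normr0 mulr_ge0 // ltW.
Qed.

Lemma is_real_diffD (V W : normedModType K) (f g : V -> W) x Lf Lg :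
  is_real_diff f x Lf -> is_real_diff g x Lg ->
  is_real_diff (fun y => f y + g y) x (fun v => Lf v + Lg v).
Proof.
move=> /is_real_diffP[lf cf hf] /is_real_diffP[lg cg hg].
apply/is_real_diffP; split=> [|y|e e0].
- split=> [u v|t u]; first by rewrite (proj1 lf) (proj1 lg) addrACA.
  by rewrite (proj2 lf) (proj2 lg) scalerDr.
- by apply: cvgD; [exact: cf|exact: cg].
have e20 : 0 < e / 2 by rewrite divr_gt0.
move: (hf _ e20) (hg _ e20); apply: filterS2 => h h1 h2.
rewrite [e]splitr mulrDl; apply: le_trans (lerD h1 h2).
have aC (a b a' b' a'' b'' : W) :
    a + b - (a' + b') - (a'' + b'') = (a - a' - a'') + (b - b' - b'').
  by rewrite !opprD (addrACA a b) (addrACA (a - a')).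
by rewrite aC ler_normD.
Qed.

Lemma is_real_diff_affine (V W : normedModType K) (L : {linear V -> W}) (c : W) x :
  continuous L -> is_real_diff (fun y => L y + c) x L.
Proof.
move=> cL; have := is_real_diffD (@is_real_diff_linear _ _ _ x cL) (is_real_diff_cst c x).
by congr is_real_diff; apply/funext => v; rewrite addr0.
Qed.

Lemma is_real_diff_pair (U V W : normedModType K) (f : U -> V) (g : U -> W) x Lf Lg :
  is_real_diff f x Lf -> is_real_diff g x Lg ->
  is_real_diff (fun y => (f y, g y)) x (fun v => (Lf v, Lg v)).
Proof.
move=> /is_real_diffP[lf cf hf] /is_real_diffP[lg cg hg].
apply/is_real_diffP; split=> [|y|e e0].
- split=> [u v|t u]; first by rewrite (proj1 lf) (proj1 lg).
  by rewrite (proj2 lf) (proj2 lg).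
- by apply: cvg_pair; [exact: cf|exact: cg].
move: (hf _ e0) (hg _ e0); apply: filterS2 => h h1 h2.
by rewrite prod_normE /= num_ge_max h1 h2.
Qed.

(** The remainder at the increment (a, u) is exactly [a *: u], which is quadratically small.
    Composed with [is_real_diff_pair] this gives the Leibniz rule. *)
Lemma is_real_diff_scale_pair (W : normedModType K) (p : K^o * W) :
  is_real_diff (fun q : K^o * W => q.1 *: q.2) p
    (fun v => p.1 *: v.2 + v.1 *: p.2).
Proof.
apply/is_real_diffP; split=> [|y|e e0].
- split=> [u v|t u]; first by rewrite /= scalerDr scalerDl addrACA.
  by rewrite /= scalerDr !scalerA mulrC.
- apply: cvgD; apply: cvgZ; [exact: cvg_cst|exact: cvg_snd|exact: cvg_fst|exact: cvg_cst].
move: (@nbhs0_lt _ (K^o * W)%type _ e0); apply: filterS => -[a u] hl /=.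
rewrite (_ : _ - _ = a *: u); last first.
  have aK (a' b' c' d' : W) : a' + b' + (c' + d') - d' - (b' + c') = a'.
    by rewrite addrA addrK -(addrA a') addrK.
  by rewrite scalerDr !scalerDl aK.
rewrite normrZ; apply: ler_pM => //.
  by apply: le_trans (ltW hl); rewrite prod_normE num_le_max lexx.
by rewrite prod_normE num_le_max lexx orbT.
Qed.

Lemma differentiable_is_real_diff (V W : normedModType K) (f : V -> W) x :
  differentiable f x -> is_real_diff f x ('d f x).
Proof.
move=> /diff_locallyP[cf hf]; split=> //.
  by move=> u v; rewrite linearD.
by move=> t u; rewrite linearZ.
Qed.

(** Together with the previous lemma, complex differentiability amounts to a real differential that
    is complex-linear. *)
Lemma is_real_diff_differentiable (V W : normedModType K) (f : V -> W) x L :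
  is_real_diff f x L -> (forall c v, L (c *: v) = c *: L v) -> differentiable f x.
Proof.
move=> [LD _ cL hf] LZ.
pose LM := GRing.isLinear.Build K V W *:%R L (fun c u v => etrans (LD (c *: u) v) (congr1 (+%R^~ (L v)) (LZ c u))).
pose L' : {linear V -> W} := HB.pack L LM.
have dE : 'd f x = L' :> (V -> W) by apply: diff_unique.
by apply/diff_locallyP; rewrite dE.
Qed.

Lemma is_real_diff_inv (z : K^o) : z != 0 ->
  is_real_diff (fun y : K^o => y^-1 : K^o) z (fun v => - (z^-1 * z^-1 * v)).
Proof.
move=> z0; have := differentiable_is_real_diff (@differentiable_Rinv _ z z0).
congr is_real_diff; rewrite diff_Rinv //; apply/funext => v /=.
by rewrite -mulNr expr2 invfM.
Qed.
End RealDerivative.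

(** * Germs of smooth and holomorphic maps *)

Section PointwiseRegularity.
Variable R : realType.
Local Notation K := R[i].
Implicit Types (U V W : normedModType K) (r : regularity).

(** A total choice of differential, equal to the zero map where none exists. By uniqueness it is the
    differential wherever there is one. *)
Definition Dr V W (f : V -> W) (x : V) : V -> W :=
  if pselect (exists L, is_real_diff f x L) is left H then sval (cid H) else fun=> 0.

Lemma Dr_eq V W (f : V -> W) x L : is_real_diff f x L -> Dr f x = L.
Proof.
move=> fL; rewrite /Dr; case: pselect => [H|]; last by case; exists L.
by case: cid => L' /= /is_real_diff_unique; apply.
Qed.

Lemma DrP V W (f : V -> W) x : (exists L, is_real_diff f x L) -> is_real_diff f x (Dr f x).
Proof. by case=> L fL; rewrite (Dr_eq fL). Qed.

Lemma Dr_near V W (f g : V -> W) x : (\forall y \near x, f y = g y) -> Dr f x = Dr g x.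
Proof.
move=> fg; rewrite /Dr.
suff -> : is_real_diff f x = is_real_diff g x by [].
apply/funext => L; apply/propext; split; apply: is_real_diff_near => //.
by move: fg; apply: filterS.
Qed.

(* The canonical derivative Dr replaces the existential one of [Ck], so that
   this condition depends only on the germ of f at x. *)
Fixpoint Ck_at V W k (f : V -> W) (x : V) : Prop :=
  if k is k'.+1 then
    (\forall y \near x, exists L, is_real_diff f y L) /\
    forall v, Ck_at k' (fun y => Dr f y v) x
  else \forall y \near x, {for y, continuous f}.

Lemma Ck_at_near V W k (f g : V -> W) x :
  (\forall y \near x, f y = g y) -> Ck_at k f x -> Ck_at k g x.
Proof.
elim: k f g => [|k IH] f g /near_interior fg /=.
  apply: filterS2 fg => y fg cf.
  rewrite /prop_for /continuous_at -(nbhs_singleton fg).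
  by apply: cvg_trans cf; apply: near_eq_cvg; exact: fg.
move=> [df hf]; split.
  by apply: filterS2 fg df => y fg [L fL]; exists L; apply: is_real_diff_near fL.
move=> v; apply: IH (hf v); apply: filterS fg => y fg.
by rewrite (Dr_near fg).
Qed.

(** Allows the derivative to be supplied by an explicit formula near x instead of [Dr]. *)
Lemma Ck_atS V W k (f : V -> W) (L : V -> V -> W) x :
  (\forall y \near x, is_real_diff f y (L y)) ->
  (forall v, Ck_at k (fun y => L y v) x) -> Ck_at k.+1 f x.
Proof.
move=> fL hL; split; first by apply: filterS fL => y; exists (L y).
move=> v; apply: Ck_at_near (hL v).
by apply: filterS fL => y /Dr_eq ->.
Qed.

Lemma Ck_at_mono V W k (f : V -> W) x : Ck_at k.+1 f x -> Ck_at k f x.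
Proof.
elim: k f => [|k IH] f.
  by case=> + _; apply: filterS => y [L /is_real_diff_continuous].
by case=> df hf; split=> // v; apply: IH; apply: hf.
Qed.

(** A family of differentials on an open set is one near each of its points, and conversely [Dr f]
    serves as the family. Smoothness thus becomes a property of germs. *)
Lemma CkP V W k (A : set V) (f : V -> W) : open A ->
  Ck k A f <-> forall x, A x -> Ck_at k f x.
Proof.
move=> oA; split; elim: k f => [|k IH] f /=.
- by move=> cf x Ax; apply: filterS (open_nbhs_nbhs (conj oA Ax)).
- move=> [L [fL hL]] x Ax; apply: (@Ck_atS _ _ _ _ L).
    by apply: filterS (open_nbhs_nbhs (conj oA Ax)).
  by move=> v; apply: IH.
- by move=> hf x Ax; apply: nbhs_singleton (hf x Ax).
- move=> hf; exists (Dr f); split=> [x Ax|v].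
    by apply: DrP; have [/nbhs_singleton] := hf x Ax.
  by apply: IH => x /hf[].
Qed.

Lemma Ck_at_cst V W k (c : W) (x : V) : Ck_at k (fun=> c) x.
Proof.
elim: k c => [|k IH] c; first by apply: nearW => y; apply: cst_continuous.
by apply: (@Ck_atS _ _ _ _ (fun=> fun=> 0)) => //; apply: nearW => y; apply: is_real_diff_cst.
Qed.

Lemma Ck_at_linear V W k (L : {linear V -> W}) x : continuous L -> Ck_at k L x.
Proof.
move=> cL; case: k => [|k]; first by apply: nearW => y; apply: cL.
apply: (@Ck_atS _ _ _ _ (fun=> L)); first by apply: nearW => y; apply: is_real_diff_linear.
by move=> v; apply: Ck_at_cst.
Qed.

Lemma Ck_at_post V W U k (L : {linear W -> U}) (f : V -> W) x : continuous L ->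
  Ck_at k f x -> Ck_at k (fun y => L (f y)) x.
Proof.
move=> cL; elim: k f => [|k IH] f.
  by apply: filterS => y cf; apply: (continuous_comp (g := L)) => //; apply: cL.
case=> df hf; apply: (@Ck_atS _ _ _ _ (fun y v => L (Dr f y v))) => [|v]; last exact: (IH _ (hf v)).
by apply: filterS df => y /DrP fy; apply: (is_real_diff_comp fy); apply: is_real_diff_linear.
Qed.

(** Affine substitution keeps the induction closed: the derivative along v of the composite is the
    derivative of f along [L v] under the same substitution. *)
Lemma Ck_at_pre U V W k (f : V -> W) (L : {linear U -> V}) c x : continuous L ->
  Ck_at k f (L x + c) -> Ck_at k (fun y => f (L y + c)) x.
Proof.
move=> cL.
have cA : continuous (fun y => L y + c).
  by move=> y; apply: is_real_diff_continuous (is_real_diff_affine c y cL).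
elim: k f => [|k IH] f.
  move=> cf; have : \forall y \near x, {for L y + c, continuous f} by exact: (cA x _ cf).
  by apply: filterS => y {}cf; apply: (continuous_comp (cA y)).
case=> df hf; apply: (@Ck_atS _ _ _ _ (fun y v => Dr f (L y + c) (L v))) => [|v].
  have {}df : \forall y \near x, exists L', is_real_diff f (L y + c) L' by exact: (cA x _ df).
  by apply: filterS df => y /DrP fy; apply: (is_real_diff_comp (is_real_diff_affine c y cL) fy).
exact: (IH _ (hf (L v))).
Qed.

Lemma Ck_atD V W k (f g : V -> W) x :
  Ck_at k f x -> Ck_at k g x -> Ck_at k (fun y => f y + g y) x.
Proof.
elim: k f g => [|k IH] f g.
  by apply: filterS2 => y cf cg; apply: continuousD.
move=> [df hf] [dg hg].
apply: (@Ck_atS _ _ _ _ (fun y v => Dr f y v + Dr g y v)) => [|v]; last exact: (IH _ _ (hf v) (hg v)).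
by apply: filterS2 df dg => y /DrP df /DrP dg; apply: is_real_diffD.
Qed.

Lemma Ck_at_pair U V W k (f : U -> V) (g : U -> W) x :
  Ck_at k f x -> Ck_at k g x -> Ck_at k (fun y => (f y, g y)) x.
Proof.
elim: k f g => [|k IH] f g.
  by apply: filterS2 => y cf cg; apply: cvg_pair.
move=> [df hf] [dg hg].
apply: (@Ck_atS _ _ _ _ (fun y v => (Dr f y v, Dr g y v))) => [|v]; last exact: (IH _ _ (hf v) (hg v)).
by apply: filterS2 df dg => y /DrP df /DrP dg; apply: is_real_diff_pair.
Qed.

Lemma Ck_atZ V W k (a : V -> K^o) (f : V -> W) x :
  Ck_at k a x -> Ck_at k f x -> Ck_at k (fun y => a y *: f y) x.
Proof.
elim: k a f => [|k IH] a f.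
  by apply: filterS2 => y ca cf; apply: cvgZ.
(* The derivative of the product still contains a and f undifferentiated, so their class k is
   recorded before class k + 1 is taken apart. *)
move=> a1 f1; have a0 := Ck_at_mono a1; have f0 := Ck_at_mono f1.
case: a1 f1 => [da ha] [df hf].
apply: (@Ck_atS _ _ _ _ (fun y v => a y *: Dr f y v + Dr a y v *: f y)) => [|v].
  apply: filterS2 da df => y /DrP da /DrP df.
  exact: (is_real_diff_comp (is_real_diff_pair da df) (is_real_diff_scale_pair _)).
by apply: Ck_atD; [exact: (IH _ _ a0 (hf v))|exact: (IH _ _ (ha v) f0)].
Qed.

Lemma Ck_atM V k (a b : V -> K^o) x :
  Ck_at k a x -> Ck_at k b x -> Ck_at k (fun y => a y * b y : K^o) x.
Proof. exact: Ck_atZ. Qed.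

Lemma Ck_at_continuous V W k (f : V -> W) x : Ck_at k f x -> {for x, continuous f}.
Proof. by elim: k => [/nbhs_singleton//|k IH] /Ck_at_mono. Qed.

Lemma near_neq0 V (f : V -> K^o) x : {for x, continuous f} -> f x != 0 ->
  \forall y \near x, f y != 0.
Proof.
move=> cf fx0; have : 0 < `|f x| by rewrite normr_gt0.
move/cvgrPdist_lt: cf => /[apply]; apply: filterS => y; apply: contraTneq => ->.
by rewrite subr0 ltxx.
Qed.

(** The derivative of 1 / f is - f^-2 Df, so class k of the inverse, from the induction hypothesis,
    gives class k + 1. *)
Lemma Ck_atV V k (f : V -> K^o) x : f x != 0 ->
  Ck_at k f x -> Ck_at k (fun y => (f y)^-1 : K^o) x.
Proof.
move=> fx0; elim: k => [|k IH] f1; have n0 := near_neq0 (Ck_at_continuous f1) fx0.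
  by move: f1 n0; apply: filterS2 => y cf fy0; apply: cvgV.
have f0 := Ck_at_mono f1; case: f1 => [df hf].
apply: (@Ck_atS _ _ _ _ (fun y v => - ((f y)^-1 * (f y)^-1 * Dr f y v))) => [|v].
  apply: filterS2 n0 df => y fy0 /DrP df.
  exact: (is_real_diff_comp df (is_real_diff_inv fy0)).
have iC := IH f0.
apply: (@Ck_at_near _ _ k (fun y => -1 * ((f y)^-1 * (f y)^-1 * Dr f y v) : K^o)).
  by apply: nearW => y; rewrite mulN1r.
by do ?apply: Ck_atM => //; [exact: Ck_at_cst|exact: hf].
Qed.

(** Complex differentiability is demanded in a neighbourhood, so that the holomorphic case also
    depends only on the germ at x. *)
Definition regular_at V W r (f : V -> W) (x : V) : Prop :=
  (forall k, Ck_at k f x) /\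
  (r = Holomorphic -> \forall y \near x, differentiable f y).

Lemma regular_onP V W r (A : set V) (f : V -> W) : open A ->
  regular_on r A f <-> forall x, A x -> regular_at r f x.
Proof.
move=> oA; have sP : smooth_on A f <-> forall x, A x -> forall k, Ck_at k f x.
  by split=> [sf x Ax k|sf k]; [move/(CkP k f oA): (sf k); apply|apply/CkP => // x /sf].
case: r => /=.
  by split=> [/sP sf x /sf|hf]; [split|apply/sP => x /hf[]].
split=> [[/sP sf df] x Ax|hf].
  by split=> [|_]; [exact: sf|apply: filterS (open_nbhs_nbhs (conj oA Ax))].
split; first by apply/sP => x /hf[].
by move=> x /hf[_ /(_ erefl)/nbhs_singleton].
Qed.

Lemma regular_at_weaken V W r (f : V -> W) x :
  regular_at Holomorphic f x -> regular_at r f x.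
Proof. by case=> h1 h2; split=> // _; apply: h2. Qed.

Lemma regular_at_near V W r (f g : V -> W) x :
  (\forall y \near x, f y = g y) -> regular_at r f x -> regular_at r g x.
Proof.
move=> fg [hf df]; split=> [k|/df {}df]; first exact: Ck_at_near (hf k).
move/near_interior: fg => fg; apply: filterS2 fg df => y fg /differentiable_is_real_diff dy.
by apply: is_real_diff_differentiable (is_real_diff_near fg dy) _ => c v; rewrite linearZ.
Qed.

Lemma regular_at_continuous V W r (f : V -> W) x : regular_at r f x -> {for x, continuous f}.
Proof. by case=> /(_ 0)/Ck_at_continuous. Qed.

Lemma regular_at_cst V W r (c : W) (x : V) : regular_at r (fun=> c) x.
Proof. by split=> [k|_]; [exact: Ck_at_cst|apply: nearW => y; exact: differentiable_cst]. Qed.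

Lemma regular_at_linear V W r (L : {linear V -> W}) x : continuous L -> regular_at r L x.
Proof.
by move=> cL; split=> [k|_]; [exact: Ck_at_linear|apply: nearW => y; exact: linear_differentiable].
Qed.

Lemma regular_at_post V W U r (L : {linear W -> U}) (f : V -> W) x : continuous L ->
  regular_at r f x -> regular_at r (fun y => L (f y)) x.
Proof.
move=> cL [hf df]; split=> [k|/df]; first exact: Ck_at_post.
by apply: filterS => y dy; apply: differentiable_comp => //; apply: linear_differentiable.
Qed.

Lemma regular_at_pre U V W r (f : V -> W) (L : {linear U -> V}) c x : continuous L ->
  regular_at r f (L x + c) -> regular_at r (fun y => f (L y + c)) x.
Proof.
move=> cL [hf df]; split=> [k|/df {}df]; first exact: Ck_at_pre.
have cA : {for x, continuous (fun y => L y + c)}.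
  exact: is_real_diff_continuous (is_real_diff_affine c x cL).
have {}df : \forall y \near x, differentiable f (L y + c) by exact: (cA _ df).
apply: filterS df => y dy.
apply: (@differentiable_comp _ _ _ _ (fun y => L y + c) f) => //.
by apply: differentiableD => //; [exact: linear_differentiable].
Qed.

Lemma regular_atD V W r (f g : V -> W) x :
  regular_at r f x -> regular_at r g x -> regular_at r (fun y => f y + g y) x.
Proof.
move=> [hf df] [hg dg]; split=> [k|rE]; first exact: Ck_atD.
by apply: filterS2 (df rE) (dg rE) => y fy gy; apply: differentiableD.
Qed.

Lemma regular_at_pair U V W r (f : U -> V) (g : U -> W) x :
  regular_at r f x -> regular_at r g x -> regular_at r (fun y => (f y, g y)) x.
Proof.
move=> [hf df] [hg dg]; split=> [k|rE]; first exact: Ck_at_pair.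
by apply: filterS2 (df rE) (dg rE) => y fy gy; apply: differentiable_pair.
Qed.

Lemma regular_atZ V W r (a : V -> K^o) (f : V -> W) x :
  regular_at r a x -> regular_at r f x -> regular_at r (fun y => a y *: f y) x.
Proof.
move=> [ha da] [hf df]; split=> [k|rE]; first exact: Ck_atZ.
apply: filterS2 (da rE) (df rE) => y ay fy.
have dS : differentiable (fun q : K^o * W => q.1 *: q.2) (a y, f y).
  apply: is_real_diff_differentiable (is_real_diff_scale_pair _) _ => c v /=.
  by rewrite scalerDr !scalerA mulrC.
exact: (@differentiable_comp _ _ _ _ (fun z => (a z, f z)) _ _ (differentiable_pair ay fy) dS).
Qed.

Lemma regular_atM V r (a b : V -> K^o) x :
  regular_at r a x -> regular_at r b x -> regular_at r (fun y => a y * b y : K^o) x.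
Proof. exact: regular_atZ. Qed.

Lemma regular_atV V r (f : V -> K^o) x : f x != 0 ->
  regular_at r f x -> regular_at r (fun y => (f y)^-1 : K^o) x.
Proof.
move=> fx0 hf; have n0 := near_neq0 (regular_at_continuous hf) fx0.
case: hf => hf df; split=> [k|/df]; first exact: Ck_atV.
by move: n0; apply: filterS2 => y fy dy; apply: differentiableV.
Qed.

Lemma regular_atX V r (f : V -> K^o) n x :
  regular_at r f x -> regular_at r (fun y => f y ^+ n : K^o) x.
Proof.
move=> hf; elim: n => [|n IH]; first exact: regular_at_cst.
apply: (@regular_at_near _ _ _ (fun y => f y * f y ^+ n)); last exact: regular_atM.
by apply: nearW => y; rewrite exprS.
Qed.

Lemma regular_at_sum V W r (I : Type) (s : seq I) (F : I -> V -> W) x :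
  (forall i, regular_at r (F i) x) -> regular_at r (fun y => \sum_(i <- s) F i y) x.
Proof.
move=> hF; elim: s => [|i s IH].
  apply: regular_at_near (regular_at_cst r (0 : W) x).
  by apply: nearW => y; rewrite big_nil.
apply: regular_at_near (regular_atD (hF i) IH).
by apply: nearW => y; rewrite big_cons.
Qed.

Lemma slice_continuous V W (c : W) : continuous (fun y : V => (y, c)).
Proof.
move=> y; have ir : regular_at Smooth (@idfun V) y.
  by apply: regular_at_linear => y'; exact: cvg_id.
exact: (regular_at_continuous (regular_at_pair ir (regular_at_cst _ c y))).
Qed.

(** The map y |-> (y, c) is affine. With c = 1 as fibre coordinate this extracts the coefficient of
    a bundle map from its coordinate expression. *)
Lemma regular_at_slice U V W r (G : V * W -> U) (x : V) (c : W) :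
  regular_at r G (x, c) -> regular_at r (fun y => G (y, c)) x.
Proof.
move=> Gr; have Lp (y : V) : (y, c) = (y, 0) + (0, c) by rewrite -[RHS]/(_, _) addr0 add0r.
have Llin : linear (fun y : V => (y, 0 : W)).
  by move=> a u v; congr pair; rewrite -[RHS]/(a *: 0 + 0) scaler0 addr0.
pose L : {linear V -> (V * W)%type} := HB.pack (fun y : V => (y, 0 : W))
  (GRing.isLinear.Build K V (V * W)%type *:%R _ Llin).
have cL : continuous L by exact: slice_continuous.
rewrite (_ : (fun y => _) = (fun y => G (L y + (0, c)))); last first.
  by apply/funext => y; rewrite Lp.
apply: (regular_at_pre cL).
have -> : L x + (0, c) = (x, c) by exact: esym (Lp _).
exact: Gr.
Qed.

Lemma regular_at_fst U V W r (u : V -> U) (x : V) (z : W) :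
  regular_at r u x -> regular_at r (fun q : V * W => u q.1) (x, z).
Proof.
move=> ur; pose L : {linear (V * W)%type -> V} := fst.
rewrite (_ : (fun q => _) = (fun q => u (L q + 0))); last first.
  by apply/funext => q; rewrite addr0.
by apply: regular_at_pre; [move=> ?; exact: cvg_fst|rewrite addr0].
Qed.

Lemma regular_at_snd V W r (x : V) (z : W) :
  regular_at r (fun q : V * W => q.2) (x, z).
Proof. by apply: (@regular_at_linear _ _ r snd) => ?; exact: cvg_snd. Qed.

Lemma near_fst V W (x : V) (z : W) (P : V -> Prop) :
  (\forall y \near x, P y) -> \forall q \near ((x, z) : V * W), P q.1.
Proof.
move=> hP; have cf : (fst : V * W -> V) @ ((x, z) : V * W) --> x by exact: cvg_fst.
exact: (cf _ hP).
Qed.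

End PointwiseRegularity.

(** * Regular maps in charts and trivializations *)

Section Charts.
Variable R : realType.
Local Notation K := R[i].

Definition charts_injective (V : Type) (X : charted V) :=
  forall (i : cidx X) x y, cdom (cchart i) x -> cdom (cchart i) y ->
    cmap (cchart i) x = cmap (cchart i) y -> x = y.

Lemma is_manifold_injective (V : normedModType K) r (X : charted V) :
  is_manifold r X -> charts_injective X.
Proof. by case=> _ iX _ i x y ix iy; apply: (iX i); rewrite inE. Qed.

Section RegularMaps.
Variables (V W : normedModType K) (X : charted V) (Y : charted W) (r : regularity).

(** The pointwise form of [regular_map]. That every y near the image of p comes from a point of the
    domain encodes openness of the domain of the coordinate expression. *)
Definition regular_in_charts (f : X -> Y) i j (p : X) :=
  exists g : V -> W, regular_at r g (cmap (cchart i) p) /\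
    \forall y \near cmap (cchart i) p, exists x,
      [/\ cdom (cchart i) x, cdom (cchart j) (f x), cmap (cchart i) x = y &
          g y = cmap (cchart j) (f x)].

Lemma regular_mapP (f : X -> Y) : charts_injective X ->
  regular_map r f <-> forall i j p, cdom (cchart i) p -> cdom (cchart j) (f p) ->
    regular_in_charts f i j p.
Proof.
move=> iX; split=> [fr i j p ip jfp|hf i j phi psi D].
  have [oD [g [/(regular_onP _ _ oD) gr gE]]] := fr i j.
  have Dp : (cmap (cchart i) @` (cdom (cchart i) `&` f @^-1` cdom (cchart j)))
    (cmap (cchart i) p) by exists p.
  exists g; split; first exact: gr.
  apply: filterS (open_nbhs_nbhs (conj oD Dp)) => y [x [ix jx] <-].
  by exists x; split=> //; apply: gE.
(* The local functions g at different points need not agree off the chart image. They are replaced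
   by one function, the coordinate expression extended by 0; injectivity of the chart makes it
   independent of the chosen preimage. *)
pose s y := if pselect (exists2 x, D x & phi x = y) is left H
  then psi (f (s2val (cid2 H))) else 0.
have sE x : D x -> s (phi x) = psi (f x).
  move=> Dx; rewrite /s; case: pselect => [H|[]]; last by exists x.
  case: cid2 => x' /= Dx' /(iX i) ->//; [exact: (proj1 Dx')|exact: (proj1 Dx)].
have oD : open (phi @` D).
  rewrite openE => _ [p [ip jp] <-].
  have [g [_ gE]] := hf i j p ip jp.
  by apply: filterS gE => y [x [ix jx <- _]]; exists x.
split=> //; exists s; split=> //; apply/regular_onP => // _ [p [ip jp] <-].
have [g [gr gE]] := hf i j p ip jp.
apply: regular_at_near gr; apply: filterS gE => y [x [ix jx <- ->]].
by rewrite sE.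
Qed.

End RegularMaps.

(** * Bundle maps and their coefficients in trivializations *)

Section BundleMaps.
Local Notation C := (K^o).
Variables (V W : normedModType K) (X : charted V) (Y : charted W).

Definition fiber_coordinates (B : Type) (E : lbundle C B) :=
  forall j p, tdom (ltriv E) j p -> forall z : C,
    exists! e, proj (l := E) e = p /\ tcoord (ltriv E) j e = z.

Lemma fiber_coordP B (E : lbundle C B) j p : fiber_coordinates E -> tdom (ltriv E) j p ->
  forall z : C, exists e, proj (l := E) e = p /\ tcoord (ltriv E) j e = z.
Proof. by move=> cE jp z; have [e [? _]] := cE j p jp z; exists e. Qed.

Lemma fiber_coord_inj B (E : lbundle C B) j p e e' : fiber_coordinates E -> tdom (ltriv E) j p ->
  proj (l := E) e = p -> proj (l := E) e' = p ->
  tcoord (ltriv E) j e = tcoord (ltriv E) j e' -> e = e'.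
Proof.
move=> cE jp ep e'p ee'; have [e0 [_ u]] := cE j p jp (tcoord (ltriv E) j e').
by rewrite -(u e) // -(u e').
Qed.

Variables (E : lbundle C X) (E' : lbundle C Y).

Lemma total_space_injective : charts_injective X -> fiber_coordinates E ->
  charts_injective (total_space E).
Proof.
move=> iX cE [i j] e e' /= [ie je] [ie' je'] [/(iX i) pE zE].
exact: (fiber_coord_inj cE je erefl (esym (pE ie ie'))).
Qed.

Definition coefficient_regular r d (h : X -> Y) (f : total E -> total E') i j j' (p : X) :=
  exists a : V -> C, regular_at r a (cmap (cchart i) p) /\
    \forall y \near cmap (cchart i) p, exists x,
      [/\ cdom (cchart i) x, tdom (ltriv E) j x, tdom (ltriv E') j' (h x),
          cmap (cchart i) x = y &
          forall e, proj e = x -> tcoord (ltriv E') j' (f e) = a y * tcoord (ltriv E) j e ^+ d].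

Lemma bundle_map_regular r d (h : X -> Y) (f : total E -> total E') :
  charts_injective X -> fiber_coordinates E ->
  (forall e, proj (f e) = h (proj e)) ->
  (forall i i' p, cdom (cchart i) p -> cdom (cchart i') (h p) ->
     regular_in_charts r h i i' p) ->
  (forall i j j' p, cdom (cchart i) p -> tdom (ltriv E) j p -> tdom (ltriv E') j' (h p) ->
     coefficient_regular r d h f i j j' p) ->
  regular_map r (X := total_space E) (Y := total_space E') f.
Proof.
move=> iX cE fh hr fr; apply/regular_mapP; first exact: total_space_injective.
move=> [i j] [i' j'] e /= [ie je]; rewrite fh => -[ihe jhe].
have [g [gr gE]] := hr i i' _ ie ihe; have [a [ar aE]] := fr i j j' _ ie je jhe.
exists (fun q : V * C => (g q.1, a q.1 * q.2 ^+ d)); split=> /=.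
  apply: regular_at_pair; first exact: regular_at_fst.
  by apply: regular_atM; [exact: regular_at_fst|apply: regular_atX; exact: regular_at_snd].
have : \forall q \near (cmap (cchart i) (proj e), tcoord (ltriv E) j e : C),
   (exists x, [/\ cdom (cchart i) x, cdom (cchart i') (h x), cmap (cchart i) x = q.1 &
          g q.1 = cmap (cchart i') (h x)]) /\ exists x,
      [/\ cdom (cchart i) x, tdom (ltriv E) j x, tdom (ltriv E') j' (h x),
          cmap (cchart i) x = q.1 &
          forall e, proj e = x -> tcoord (ltriv E') j' (f e) = a q.1 * tcoord (ltriv E) j e ^+ d].
  exact: near_fst (filterI gE aE).
apply: filterS => -[y z] /= [[x [ix ihx <- gy]] [x' [ix' jx' jhx' /(iX i) xx' fx']]].
rewrite (xx' ix' ix) in jx' jhx' fx'.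
have [e' [pe' ze']] := fiber_coordP cE jx' z.
by exists e'; rewrite !fh pe' ze' fx' // -ze' gy.
Qed.

(** The converse of [bundle_map_regular]: restricting the coordinate expression to z = 1 leaves the
    base map and the coefficient as its two components, because 1 ^ d = 1. *)
Lemma bundle_map_regularP r d (h : X -> Y) (f : total E -> total E') :
  charts_injective X -> fiber_coordinates E ->
  (forall e, proj (f e) = h (proj e)) ->
  fiber_homogeneous d (E := E) (E' := E') h f ->
  regular_map r (X := total_space E) (Y := total_space E') f ->
  forall i j i' j' p, cdom (cchart i) p -> tdom (ltriv E) j p ->
    cdom (cchart i') (h p) -> tdom (ltriv E') j' (h p) ->
  regular_in_charts r h i i' p /\ coefficient_regular r d h f i j j' p.
Proof.
move=> iX cE fh fd /regular_mapP fr i j i' j' p ip jp i'p j'p.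
have [e [pe ze]] := fiber_coordP cE jp 1.
have [||G [Gr GE]] := fr (total_space_injective iX cE) (i, j) (i', j') e.
- by rewrite /= pe.
- by rewrite /= fh pe.
have {}Gr : regular_at r G (cmap (cchart i) p, 1) by rewrite -pe -ze.
have {}GE := GE; rewrite [cmap _ e](_ : _ = (cmap (cchart i) p, 1)) in GE; last by rewrite /= pe ze.
have Gr1 := regular_at_slice Gr.
have : \forall y \near cmap (cchart i) p, exists x,
      [/\ cdom (cchart i) x, tdom (ltriv E) j x, cdom (cchart i') (h x) /\ tdom (ltriv E') j' (h x),
          cmap (cchart i) x = y &
          (G (y, 1)).1 = cmap (cchart i') (h x) /\
          forall e, proj e = x -> tcoord (ltriv E') j' (f e) = (G (y, 1)).2 * tcoord (ltriv E) j e ^+ d].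
  have {}GE := @slice_continuous _ _ _ (1 : C) _ _ GE.
  near=> y.
  have [e' [[/= ie' je'] + [yE zE] ->]] : exists x, [/\ cdom (cchart (c := total_space E) (i, j)) x, cdom (cchart (c := total_space E') (i', j')) (f x), cmap (cchart (c := total_space E) (i, j)) x = (y, 1) & G (y, 1) = cmap (cchart (c := total_space E') (i', j')) (f x)] by near: y; exact: GE.
  move=> -[/= ihe jhe]. rewrite fh in ihe jhe; exists (proj e'); split=> //=; split; first by rewrite fh.
  have [a [_ aE]] := fd _ _ _ je' jhe.
  by move=> e1 /aE ->; rewrite aE // zE expr1n mulr1.
move=> H; split.
  exists (fun y => (G (y, 1)).1); split.
    have c1 : continuous (fst : W * C -> W) by move=> ?; exact: cvg_fst.
    exact: (@regular_at_post _ _ _ _ r (fst : {linear (W * C)%type -> W}) _ _ c1 Gr1).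
  by apply: filterS H => y [x [? ? [? ?] ? [? ?]]]; exists x.
exists (fun y => (G (y, 1)).2); split.
  have c2 : continuous (snd : W * C -> C) by move=> ?; exact: cvg_snd.
  exact: (@regular_at_post _ _ _ _ r (snd : {linear (W * C)%type -> C}) _ _ c2 Gr1).
by apply: filterS H => y [x [? ? [? ?] ? [? ?]]]; exists x.
Unshelve. all: by end_near.
Qed.

(** Evaluation at the vector of fibre coordinate 1 identifies a with the nonzero constant of
    [fiber_homogeneous]. *)
Lemma coefficient_neq0 d (h : X -> Y) (f : total E -> total E') p j j' (a : C) :
  fiber_coordinates E -> fiber_homogeneous d (E := E) (E' := E') h f ->
  tdom (ltriv E) j p -> tdom (ltriv E') j' (h p) ->
  (forall e, proj e = p -> tcoord (ltriv E') j' (f e) = a * tcoord (ltriv E) j e ^+ d) ->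
  a != 0.
Proof.
move=> cE fh jp j'p aE; have [a' [a'0 a'E]] := fh p j j' jp j'p.
have [e [ep e1]] := fiber_coordP cE jp 1.
by have := aE e ep; rewrite (a'E e ep) e1 expr1n !mulr1 => <-.
Qed.

Definition vector_coefficient_regular r (F : normedModType K) (w : total E -> F) i j (p : X) :=
  exists u : V -> F, regular_at r u (cmap (cchart i) p) /\
    \forall y \near cmap (cchart i) p, exists x,
      [/\ cdom (cchart i) x, tdom (ltriv E) j x, cmap (cchart i) x = y &
          forall e, proj e = x -> w e = (tcoord (ltriv E) j e : K) *: u y].

(** The analogue for fibrewise linear maps into a normed space: the coefficient u is the value at
    fibre coordinate 1. *)
Lemma linear_map_regularP r (F : normedModType K) (w : total E -> F) :
  charts_injective X -> fiber_coordinates E ->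
  (forall p j, tdom (ltriv E) j p -> exists u : F, forall e, proj e = p ->
     w e = (tcoord (ltriv E) j e : K) *: u) ->
  regular_map r (X := total_space E) (Y := affine_space F) w <->
  forall i j p, cdom (cchart i) p -> tdom (ltriv E) j p -> vector_coefficient_regular r w i j p.
Proof.
move=> iX cE wl; apply: iff_trans (regular_mapP _ _ (total_space_injective iX cE)) _.
split=> [wr i j p ip jp|wr [i j] [] e /= [ie je] _].
  have [e [pe ze]] := fiber_coordP cE jp 1.
  have [||G [Gr GE]] := wr (i, j) tt e; rewrite /= ?pe //.
  have {}Gr : regular_at r G (cmap (cchart i) p, 1) by rewrite -pe -ze.
  rewrite [cmap _ e](_ : _ = (cmap (cchart i) p, 1)) in GE; last by rewrite /= pe ze.
  exists (fun y => G (y, 1)); split; first exact: regular_at_slice Gr.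
  have : \forall y \near cmap (cchart i) p, exists x,
      [/\ cdom (cchart (c := total_space E) (i, j)) x, True,
          cmap (cchart (c := total_space E) (i, j)) x = (y, 1) & G (y, 1) = w x].
    exact: (@slice_continuous _ _ _ (1 : C) _ _ GE).
  apply: filterS => y [e' [[/= ie' je'] _ [yE zE] ->]]; exists (proj e'); split=> //.
  have [u uE] := wl _ _ je'.
  by move=> e1 /uE ->; rewrite uE // zE scale1r.
have [u [ur uE]] := wr i j _ ie je.
exists (fun q : V * C => q.2 *: u q.1); split=> /=.
  by apply: regular_atZ; [exact: regular_at_snd|exact: regular_at_fst].
have := near_fst (tcoord (ltriv E) j e : C) uE.
apply: filterS => -[y z] /= [x [ix jx <- we]].
have [e' [pe' ze']] := fiber_coordP cE jx z.
by exists e'; rewrite pe' ze'; split=> //; rewrite (we _ pe') ze'.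
Qed.

End BundleMaps.
End Charts.

(** * Tangent vectors *)

Lemma derive1_chain (K : numFieldType) (f g : K^o -> K^o) (x : K^o) :
  differentiable f x -> differentiable g (f x) ->
  derive1 (g \o f) x = derive1 g (f x) * derive1 f x.
Proof.
move=> df dg; rewrite (derive1E' (differentiable_comp df dg)) (derive1E' df) (derive1E' dg).
rewrite (diff_comp df dg) [LHS]/=.
have dZ (L : {linear K^o -> K^o}) (a : K) : L a = L 1 * a.
  by rewrite -[a in LHS]mulr1 (linearZ_LR L a 1) mulrC.
exact: dZ.
Qed.

Section TangentCoordinates.
Variables (R : realType) (M : riemann_surface R).
Local Notation K := R[i].
Local Notation C := (K^o).
Local Notation M' := (rs_charted M).
Local Notation phi i := (cmap (rs_chart (r := M) i)).
Local Notation dom i := (cdom (rs_chart (r := M) i)).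

Lemma surface_charts_injective : charts_injective M'.
Proof. exact: is_manifold_injective (rs_atlas M). Qed.

Lemma surface_id_regular r i i' (p : M) : dom i p -> dom i' p ->
  regular_in_charts r (X := M') (Y := M') id i i' p.
Proof.
move=> ip i'p; have [_ _] := rs_atlas M.
move/(regular_mapP _ _ surface_charts_injective) => /(_ i i' p ip i'p)[g [gr gE]].
by exists g; split=> //; exact: regular_at_weaken.
Qed.

Definition transition i j (g : C -> C) := forall x, dom i x -> dom j x -> g (phi i x) = phi j x.

Lemma near_overlap i j p : dom i p -> dom j p ->
  \forall y \near (phi i p : C), exists x, [/\ dom i x, dom j x & phi i x = y].
Proof.
move=> ip jp; have [g [_ ]] := surface_id_regular Smooth ip jp.
by apply: filterS => y [x [? ? ? _]]; exists x.
Qed.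

(** The image of the overlap is open, so two functions extending the same transition map agree near
    the point. *)
Lemma transition_derivative i j p g h : dom i p -> dom j p ->
  transition i j g -> transition i j h -> derive1 g (phi i p) = derive1 h (phi i p).
Proof.
move=> ip jp gE hE; rewrite !derive1E; apply: near_eq_derive.
by apply: filterS (near_overlap ip jp) => y [x [ix jx <-]]; rewrite gE // hE.
Qed.

Lemma transition_ex i j : exists2 g, transition i j g &
  forall p, dom i p -> dom j p -> differentiable g (phi i p).
Proof.
have [_ _ /(_ i j)[oD [g [[_ gd] gE]]]] := rs_atlas M.
exists g => [x ix jx|p ip jp]; first exact: gE.
by apply: gd; exists p.
Qed.

Lemma transition_derivative_comp i j k p g h f : dom i p -> dom j p -> dom k p ->
  transition i j g -> transition j k h -> transition i k f ->
  derive1 f (phi i p) = derive1 h (phi j p) * derive1 g (phi i p).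
Proof.
move=> ip jp kp gE hE fE.
(* The given functions are prescribed only on overlaps, so they are exchanged for representatives
   whose differentiability comes from the atlas. *)
have [g' g'E /(_ _ ip jp) g'd] := transition_ex i j.
have [h' h'E /(_ _ jp kp) h'd] := transition_ex j k.
rewrite (transition_derivative ip jp gE g'E) (transition_derivative jp kp hE h'E).
have gp : g' (phi i p) = phi j p by exact: g'E.
have chain : derive1 (h' \o g') (phi i p) = derive1 h' (phi j p) * derive1 g' (phi i p).
  rewrite -[in X in _ = derive1 h' X * _]gp.
  rewrite -[in phi j p]gp in h'd.
  exact: (derive1_chain g'd h'd).
rewrite -chain.
rewrite !derive1E; apply: near_eq_derive.
move: (near_overlap ip jp) (near_overlap ip kp).
apply: filterS2 => y [x [ix jx <-]] [x' [ix' kx' xx']].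
have kx : dom k x by rewrite -(surface_charts_injective ix' ix xx').
by rewrite fE //= g'E // h'E.
Qed.

(** A vector is rebuilt from its i-th component z by multiplying with the derivatives of the
    transitions out of chart i. The cocycle rule makes the result a tangent vector, and the zeros in
    the charts away from p make it unique. *)
Lemma tangent_coordinates : fiber_coordinates (TM M).
Proof.
move=> i p /= ip z.
have /choice[T TE] : forall j, exists g, transition i j g.
  by move=> j; have [g] := transition_ex i j; exists g.
have [v vE v0] : exists2 v : rs_idx M -> C,
    (forall j, dom j p -> v j = derive1 (T j) (phi i p) * z) &
    (forall j, ~ dom j p -> v j = 0).
  exists (fun j => if pselect (dom j p) then derive1 (T j) (phi i p) * z else 0).
    by move=> j jp; case: pselect.
  by move=> j jp; case: pselect.
have vt : is_tangent p v.
  split=> // j k jp kp g gE; rewrite (vE k kp) (vE j jp).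
  by rewrite (transition_derivative_comp ip jp kp (TE j) gE (TE k)) [RHS]mulrA.
have vi : v i = z.
  rewrite (vE i ip) (transition_derivative ip ip (TE i) (_ : transition i i id)) => [|//].
  by rewrite derive1E derive_id mul1r.
exists (exist _ (p, v) vt); split; first by split.
move=> [[p' v'] /= vt'] /= [pE v'i]; move: vt'; rewrite pE {p' pE} => vt'.
apply/eq_exist => /=; congr pair; apply/funext => j.
have [jp|jp] := pselect (dom j p); last by rewrite (proj1 vt) // (proj1 vt').
by rewrite (vE j jp) (proj2 vt' i j ip jp _ (TE j)) v'i.
Qed.

End TangentCoordinates.

(** * The map theta and the projective line *)

Section Theta.
Variable R : realType.
Local Notation K := R[i].
Local Notation C := (K^o).
Implicit Types (v : 'rV[K]_2) (u : 'rV[K]_3).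

(* The quadratic forms z_k ^ 2 and z_0 z_1 are linear functions of theta(z). *)
Definition theta_sq (k : 'I_2) u : K := ((-1) ^+ k * u 0 0 - 'i * u 0 1) / 2.
Definition theta_prod u : K := u 0 2 / 2.

Lemma theta0 v : theta v 0 0 = v 0 0 ^+ 2 - v 0 1 ^+ 2.
Proof. by rewrite mxE. Qed.
Lemma theta1 v : theta v 0 1 = 'i * (v 0 0 ^+ 2 + v 0 1 ^+ 2).
Proof. by rewrite mxE. Qed.
Lemma theta2 v : theta v 0 2 = 2 * v 0 0 * v 0 1.
Proof. by rewrite mxE. Qed.

Lemma ord2P (P : 'I_2 -> Prop) : P 0 -> P 1 -> forall k, P k.
Proof.
move=> P0 P1 [[|[|//]] k]; [move: P0|move: P1]; congr P; exact: val_inj.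
Qed.

Lemma ord3P (P : 'I_3 -> Prop) : P 0 -> P 1 -> P 2 -> forall k, P k.
Proof.
move=> P0 P1 P2 [[|[|[|//]]] k]; [move: P0|move: P1|move: P2]; congr P; exact: val_inj.
Qed.

Lemma imul_i : 'i * 'i = -1 :> K.
Proof. by rewrite -expr2 sqrCi. Qed.

Lemma theta_sqE k v : theta_sq k (theta v) = v 0 k ^+ 2.
Proof.
rewrite /theta_sq theta0 theta1 mulrA imul_i.
elim/ord2P: k; rewrite ?expr0 ?expr1 /=; by field.
Qed.

Lemma theta_prodE v : theta_prod (theta v) = v 0 0 * v 0 1.
Proof. by rewrite /theta_prod theta2; field. Qed.

Lemma theta_sqZ k c u : theta_sq k (c *: u) = c * theta_sq k u.
Proof. by rewrite /theta_sq !mxE; field. Qed.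

(** The three functionals are linear coordinates on C^3: with s_k for [theta_sq k] and m for
    [theta_prod], u = (s_0 - s_1, i (s_0 + s_1), 2 m). *)
Lemma theta_eq u u' : theta_sq 0 u = theta_sq 0 u' -> theta_sq 1 u = theta_sq 1 u' ->
  theta_prod u = theta_prod u' -> u = u'.
Proof.
move=> h0 h1 h2; apply/rowP; elim/ord3P.
- have E (z : 'rV[K]_3) : z 0 0 = theta_sq 0 z - theta_sq 1 z by rewrite /theta_sq expr0 expr1; field.
  by rewrite (E u) (E u') h0 h1.
- have E (z : 'rV[K]_3) : z 0 1 = 'i * (theta_sq 0 z + theta_sq 1 z).
    rewrite /theta_sq expr0 expr1.
    rewrite (_ : _ + _ = - ('i * z 0 1)); last by field.
    by rewrite mulrN mulrA imul_i mulN1r opprK.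
  by rewrite (E u) (E u') h0 h1.
- have E (z : 'rV[K]_3) : z 0 2 = 2 * theta_prod z by rewrite /theta_prod; field.
  by rewrite (E u) (E u') h2.
Qed.

Lemma thetaZ c v : theta (c *: v) = c ^+ 2 *: theta v.
Proof.
apply/rowP; elim/ord3P; rewrite [RHS]mxE ?theta0 ?theta1 ?theta2 !mxE; ring.
Qed.

Lemma theta_null v : \sum_(k < 3) theta v 0 k ^+ 2 = 0.
Proof.
rewrite 3!big_ord_recl big_ord0.
have -> : lift ord0 ord0 = 1 :> 'I_3 by exact: val_inj.
have -> : lift ord0 (lift ord0 ord0) = 2 :> 'I_3 by exact: val_inj.
rewrite theta0 theta1 theta2 (exprMn _ 'i) sqrCi; ring.
Qed.

Lemma theta_eq0 v : theta v = 0 -> v = 0.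
Proof.
move=> h; apply/rowP => k; rewrite mxE; apply/eqP.
by rewrite -sqrf_eq0 -theta_sqE h -(scale0r (0 : 'rV_3)) theta_sqZ mul0r.
Qed.

(** The squares determine each component up to sign, and the product of the components forces the
    two signs to agree unless a component vanishes. *)
Lemma theta_inj v v' : theta v = theta v' -> v = v' \/ v = - v'.
Proof.
move=> h; have sq k : v 0 k ^+ 2 = v' 0 k ^+ 2 by rewrite -!theta_sqE h.
have pr : v 0 0 * v 0 1 = v' 0 0 * v' 0 1 by rewrite -!theta_prodE h.
have sgn k : v 0 k = v' 0 k \/ v 0 k = - v' 0 k.
  by have /eqP := sq k; rewrite eqf_sqr => /orP[] /eqP; [left|right].
have rE (a b : 'rV[K]_2) : a 0 0 = b 0 0 -> a 0 1 = b 0 1 -> a = b.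
  by move=> e0 e1; apply/rowP; elim/ord2P.
have n0 (a : K) : a = - a -> a = 0.
  by move=> e; apply/eqP; rewrite -[_ == _](mulrn_eq0 a 2) mulr2n {2}e subrr.
have [e0|e0] := sgn 0; have [e1|e1] := sgn 1.
- by left; apply: rE.
- have [z|nz] := eqVneq (v' 0 0) 0; first by right; apply: rE; rewrite mxE // e0 z oppr0.
  left; apply: rE => //; move: pr; rewrite e0 => /(mulfI nz) ->//.
- have [z|nz] := eqVneq (v' 0 0) 0; first by left; apply: rE; rewrite // e0 z oppr0.
  right; apply: rE; rewrite mxE // e1; apply: (mulfI nz).
  by rewrite mulrN -[in RHS]pr e0 e1 mulNr opprK.
- by right; apply: rE; rewrite mxE.
Qed.

(** On the quadric [theta_prod u ^+ 2] is the product of the two values [theta_sq]. So v_0 is a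
    square root of [theta_sq 0 u] and v_1 is [theta_prod u] / v_0; if v_0 = 0 then [theta_prod u]
    vanishes and v_1 is a square root of [theta_sq 1 u]. *)
Lemma theta_surj u : \sum_(k < 3) u 0 k ^+ 2 = 0 -> exists v, theta v = u.
Proof.
rewrite 3!big_ord_recl big_ord0.
have -> : lift ord0 ord0 = 1 :> 'I_3 by exact: val_inj.
have -> : lift ord0 (lift ord0 ord0) = 2 :> 'I_3 by exact: val_inj.
rewrite addr0 => u0.
have PP : theta_prod u ^+ 2 = theta_sq 0 u * theta_sq 1 u.
  rewrite /theta_sq /theta_prod expr0 expr1 mul1r mulN1r.
  have -> : (u 0 0 - 'i * u 0 1) / 2 * ((- u 0 0 - 'i * u 0 1) / 2)
     = (('i * 'i) * u 0 1 ^+ 2 - u 0 0 ^+ 2) / 4 by field.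
  rewrite imul_i.
  have -> : (u 0 2 / 2) ^+ 2 = u 0 2 ^+ 2 / 4 by field.
  congr (_ / _); apply/eqP; rewrite -subr_eq0 -u0; apply/eqP; ring.
pose mk (a b : K) : 'rV[K]_2 := \row_k [:: a; b]`_k.
have mk0 a b : mk a b 0 0 = a by rewrite mxE.
have mk1 a b : mk a b 0 1 = b by rewrite mxE.
have [z|nz] := eqVneq (theta_sq 0 u) 0.
  exists (mk 0 (sqrtC (theta_sq 1 u))); apply: theta_eq.
  - by rewrite theta_sqE mk0 expr0n z.
  - by rewrite theta_sqE mk1 sqrtCK.
  - rewrite theta_prodE mk0 mul0r; apply/esym/eqP.
    by rewrite -sqrf_eq0 PP z mul0r.
set s := sqrtC (theta_sq 0 u).
have s0 : s != 0 by rewrite sqrtC_eq0.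
exists (mk s (theta_prod u / s)); apply: theta_eq.
- by rewrite theta_sqE mk0 sqrtCK.
- by rewrite theta_sqE mk1 expr_div_n PP sqrtCK mulrC mulKf.
- by rewrite theta_prodE mk0 mk1 mulrC divfK.
Qed.

End Theta.

(** * Charts of the projective line in terms of arbitrary vectors of a line *)

Section ProjectiveLine.
Variable R : realType.
Local Notation K := R[i].
Local Notation C := (K^o).
Implicit Types (v : 'rV[K]_2) (L : CP1 R).
Local Notation cdom k := (cdom (cchart (c := CP1_charted R) k)).
Local Notation cmap k := (cmap (cchart (c := CP1_charted R) k)).

Lemma line_vpick L : vpick (sval L) != 0 /\ vpick (sval L) \in sval L.
Proof.
split; last exact: memv_pick.
by rewrite vpick0 -dimv_eq0 (eqP (valP L)).
Qed.

Lemma line_colinear L v v' : v \in sval L -> v != 0 -> v' \in sval L ->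
  exists c : K, v' = c *: v.
Proof.
move=> vL v0 v'L; apply/vlineP; suff -> : <[v]>%VS = sval L by [].
by apply/eqP; rewrite eqEdim -memvE vL dim_vline v0 (eqP (valP L)).
Qed.

Lemma line_eq L L' v : v != 0 -> v \in sval L -> v \in sval L' -> L = L'.
Proof.
move=> v0 vL vL'; apply: val_inj => /=.
have E (N : CP1 R) : v \in sval N -> sval N = <[v]>%VS.
  by move=> vN; apply/esym/eqP; rewrite eqEdim -memvE vN dim_vline v0 (eqP (valP N)).
by rewrite (E L) // (E L').
Qed.

Lemma line_of v : v != 0 -> exists L, v \in sval L.
Proof.
move=> v0; have dv : \dim <[v]>%VS == 1%N by rewrite dim_vline v0.
by exists (exist (fun N : {vspace 'rV[K]_2} => \dim N == 1%N) _ dv); exact: memv_line.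
Qed.

(** The charts are defined through the vector [vpick]; since any nonzero vector of the line is a
    nonzero multiple of it, any such vector may be used instead. *)
Lemma CP1_domE L v k : v != 0 -> v \in sval L -> cdom k L <-> v 0 k != 0.
Proof.
move=> v0 vL; have [p0 pL] := line_vpick L.
have [c cE] := line_colinear pL p0 vL.
have c0 : c != 0 by apply: contraNneq v0 => c0; rewrite cE c0 scale0r.
by rewrite /= cE mxE mulf_eq0 negb_or c0.
Qed.

Lemma CP1_mapE L v k : cdom k L -> v \in sval L -> v 0 (rev_ord k) = v 0 k * cmap k L.
Proof.
move=> /= kL vL; have [p0 pL] := line_vpick L.
have [c cE] := line_colinear pL p0 vL.
by rewrite {1 2}cE !mxE -mulrA; congr (_ * _); rewrite mulrC divfK.
Qed.

Lemma CP1_cover L : exists k, cdom k L.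
Proof.
have [p0 pL] := line_vpick L.
apply: contrapT => h; move/negP: p0; apply; apply/eqP/rowP => k; rewrite mxE.
by apply: contrapT => /eqP hk; apply: h; exists k.
Qed.

(** The spanning vector of the line with k-th chart coordinate t, normalized to have k-th component
    1: the local frame of O(-1). *)
Definition chart_vec (k : 'I_2) (t : K) : 'rV[K]_2 := \row_j if j == k then 1 else t.

Lemma chart_vecE L k v : cdom k L -> v \in sval L -> v = v 0 k *: chart_vec k (cmap k L).
Proof.
move=> kL vL; apply/rowP => j; rewrite !mxE.
have [->|jk] := eqVneq j k; first by rewrite mulr1.
rewrite -CP1_mapE //; congr (v 0 _); apply: val_inj => /=.
by move: j k jk {kL} => [[|[|//]] ?] [[|[|//]] ?].
Qed.

Lemma chart_vec_mem L k (z : K) : cdom k L -> z *: chart_vec k (cmap k L) \in sval L.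
Proof.
move=> kL; have [p0 pL] := line_vpick L; rewrite memvZ //.
have pk : vpick (sval L) 0 k != 0 by exact: kL.
have -> : chart_vec k (cmap k L) = (vpick (sval L) 0 k)^-1 *: vpick (sval L).
  by rewrite {2}(chart_vecE kL pL) scalerA mulVf // scale1r.
exact: memvZ.
Qed.

Lemma chart_vec_at k t : chart_vec k t 0 k = 1.
Proof. by rewrite mxE eqxx. Qed.

Lemma theta_chart L k v : cdom k L -> v \in sval L ->
  theta v = v 0 k ^+ 2 *: theta (chart_vec k (cmap k L)).
Proof. by move=> kL vL; rewrite {1}(chart_vecE kL vL) thetaZ. Qed.

End ProjectiveLine.

(** * Regularity of vector-valued functions and of theta *)

Section RowRegularity.
Variable R : realType.
Local Notation K := R[i].
Local Notation C := (K^o).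
Variables (V : normedModType K) (r : regularity) (x : V).

Lemma regular_at_row n (u : V -> 'rV[K]_n.+1) :
  (forall k, regular_at r (fun y => u y 0 k : C) x) -> regular_at r u x.
Proof.
move=> ur; have -> : u = (fun y => \sum_k u y 0 k *: 'e_k).
  by apply/funext => y; exact: row_sum_delta.
apply: regular_at_sum => k; apply: (@regular_atZ _ _ _ r (fun y => u y 0 k : C)) => //.
exact: regular_at_cst.
Qed.

Lemma regular_at_coord n (u : V -> 'rV[K]_n.+1) k :
  regular_at r u x -> regular_at r (fun y => u y 0 k : C) x.
Proof.
have lin : linear (fun v : 'rV[K]_n.+1 => v 0 k : C) by move=> a v v'; rewrite !mxE.
pose L : {linear 'rV[K]_n.+1 -> C} := HB.pack (fun v : 'rV[K]_n.+1 => v 0 k : C)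
  (GRing.isLinear.Build K 'rV[K]_n.+1 C *:%R _ lin).
have cL : continuous (fun v : ('rV[K]_n.+1 : normedModType K) => v 0 k : C).
  exact: coord_continuous.
exact: (@regular_at_post _ _ _ _ r L u x cL).
Qed.

Lemma regular_at_theta_sq k (u : V -> 'rV[K]_3) :
  regular_at r u x -> regular_at r (fun y => theta_sq k (u y) : C) x.
Proof.
move=> ur; have c0 := regular_at_coord 0 ur; have c1 := regular_at_coord 1 ur.
have -> : (fun y => theta_sq k (u y) : C) =
    (fun y => ((-1) ^+ k / 2) * (u y 0 0 : C) + (- 'i / 2) * (u y 0 1 : C)).
  by apply/funext => y; rewrite /theta_sq; field.
by apply: regular_atD; apply: regular_atM => //; exact: regular_at_cst.
Qed.

Lemma regular_at_chart_vec k (t : V -> C) :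
  regular_at r t x -> regular_at r (fun y => chart_vec k (t y)) x.
Proof.
move=> tr; apply: regular_at_row => j.
have [jk|jk] := boolP (j == k).
  by under eq_fun do rewrite mxE jk; exact: regular_at_cst.
by under eq_fun do rewrite mxE (negPf jk).
Qed.

Lemma regular_at_theta (v : V -> 'rV[K]_2) :
  regular_at r v x -> regular_at r (fun y => theta (v y)) x.
Proof.
move=> vr; have c0 := regular_at_coord 0 vr; have c1 := regular_at_coord 1 vr.
have q0 := regular_atM c0 c0; have q1 := regular_atM c1 c1; have p := regular_atM c0 c1.
have k c := regular_at_cst (R := R) (W := C) r (c : C) x.
apply: regular_at_row; elim/ord3P.
- have -> : (fun y => theta (v y) 0 0 : C) =
      (fun y => (v y 0 0 : C) * (v y 0 0 : C) + -1 * ((v y 0 1 : C) * (v y 0 1 : C))).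
    by apply/funext => y; rewrite theta0; ring.
  by apply: regular_atD => //; exact: regular_atM.
- have -> : (fun y => theta (v y) 0 1 : C) =
      (fun y => 'i * ((v y 0 0 : C) * (v y 0 0 : C) + (v y 0 1 : C) * (v y 0 1 : C))).
    by apply/funext => y; rewrite theta1 !expr2.
  by apply: regular_atM => //; exact: regular_atD.
- have -> : (fun y => theta (v y) 0 2 : C) = (fun y => 2 * ((v y 0 0 : C) * (v y 0 1 : C))).
    by apply/funext => y; rewrite theta2 mulrA.
  exact: regular_atM.
Qed.

End RowRegularity.

(** * Forms and spinors *)

Section Correspondence.
Variables (R : realType) (M : riemann_surface R).
Local Notation K := R[i].
Local Notation C := (K^o).
Local Notation M' := (rs_charted M).
Local Notation TM := (TM M).
Local Notation taut := (taut R).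
Local Notation phi i := (cmap (rs_chart (r := M) i)).
Local Notation dom i := (cdom (rs_chart (r := M) i)).
Local Notation cdom1 k := (cdom (cchart (c := CP1_charted R) k)).
Local Notation cmap1 k := (cmap (cchart (c := CP1_charted R) k)).
Implicit Types (w : vform M) (p : M).

Lemma eq_taut (e e' : total taut) : proj e = proj e' -> taut_vec e = taut_vec e' -> e = e'.
Proof.
move: e e' => [[L v] h] [[L' v'] h'] /= E E'; apply/val_inj.
by rewrite /= E; congr pair; exact: E'.
Qed.

Lemma tangent_vector p i (z : C) : dom i p ->
  exists X, proj (l := TM) X = p /\ tcoord (ltriv TM) i X = z.
Proof. by move=> ip; exact: (@fiber_coordP _ _ TM i p (@tangent_coordinates _ M) ip). Qed.

Lemma tangent_inj p i (X X' : total TM) : dom i p -> proj X = p -> proj X' = p ->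
  tcoord (ltriv TM) i X = tcoord (ltriv TM) i X' -> X = X'.
Proof. by move=> ip; exact: (@fiber_coord_inj _ _ TM i p _ _ (@tangent_coordinates _ M) ip). Qed.

(** The pointwise algebraic content of a Weierstrass representation, separated from its
    smoothness. *)
Definition nonzero_null_form w := forall p i, dom i p -> exists u : 'rV[K]_3,
  [/\ u != 0, \sum_(k < 3) u 0 k ^+ 2 = 0 &
      forall X, proj (l := TM) X = p -> w X = (tcoord (ltriv TM) i X : K) *: u].

Lemma weierstrass_nonzero_null w : weierstrass w -> nonzero_null_form w.
Proof.
case=> -[wl _] wn w0 p i ip; have [u uE] := wl p i ip; exists u; split=> //.
  have [X [Xp]] := wn p; rewrite uE //; apply: contraNneq => ->.
  by rewrite scaler0.
have [X [Xp X1]] := tangent_vector 1 ip.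
by have := w0 X; rewrite uE // X1 scale1r.
Qed.

Lemma nonzero_null_inj w p (X X' : total TM) : nonzero_null_form w ->
  proj X = p -> proj X' = p -> w X = w X' -> X = X'.
Proof.
move=> wn Xp X'p wX; have [/(_ p)[i ip] _ _] := rs_atlas M.
have [u [u0 _ uE]] := wn p i ip.
apply: (tangent_inj ip) => //.
have /eqP : ((tcoord (ltriv TM) i X : K) - tcoord (ltriv TM) i X') *: u = 0.
  by rewrite scalerBl -uE // -uE // wX subrr.
by rewrite scaler_eq0 (negPf u0) orbF subr_eq0 => /eqP.
Qed.

(** The property defining the Gauss map, stated for any eta so that it also applies to the base map
    of a spinor. *)
Definition lifts_form w (eta : M -> CP1 R) := forall p,
  @theta R @` [set v | v \in sval (eta p)] = w @` [set X | proj (l := TM) X = p].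

Lemma gauss_map_lifts w : nonzero_null_form w -> lifts_form w (gauss_map w).
Proof.
move=> wn p; rewrite /gauss_map; set P := (P in xget _ P).
suff : exists L, P L by exact: xgetPex.
have [/(_ p)[i ip] _ _] := rs_atlas M.
have [u [u0 /theta_surj[v vE] uE]] := wn p i ip.
have v0 : v != 0.
  by apply: contraNneq u0 => v0; rewrite -vE v0 -(scale0r 0) thetaZ expr0n scale0r.
have [L vL] := line_of v0; exists L; rewrite /P /=; apply/seteqP; split=> [_ [v' v'L <-]|_ [X Xp <-]].
  have [c ->] := line_colinear vL v0 v'L.
  have [X [Xp Xc]] := tangent_vector (c ^+ 2) ip.
  by exists X; rewrite // uE // Xc thetaZ vE.
(* Since theta is quadratic, scaling its value by the coordinate of X takes a square root of that
   coordinate on v. *)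
exists (sqrtC (tcoord (ltriv TM) i X : K) *: v); first exact: memvZ.
by rewrite thetaZ vE sqrtCK uE.
Qed.

(** A nonzero v in one line has the same theta as some v' in the other, so v = v' or v = - v' lies
    in both lines. *)
Lemma lifts_form_unique w eta eta' : lifts_form w eta -> lifts_form w eta' -> eta = eta'.
Proof.
move=> h h'; apply/funext => p; have [v0 vL] := line_vpick (eta p).
set v := vpick _ in v0 vL.
have : (@theta R @` [set v | v \in sval (eta' p)]) (theta v).
  by rewrite h' -h; exists v.
case=> v' /= v'L /theta_inj[] vE; apply: (@line_eq _ _ _ v) => //.
  by rewrite -vE.
by rewrite -memvN -vE.
Qed.

(** * The base map eta expressed through the form *)

Section Lifted.
Variables (w : vform M) (eta : M -> CP1 R).
Hypothesis weta : lifts_form w eta.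

Lemma lifts_form_vec p v : v \in sval (eta p) ->
  exists X, proj (l := TM) X = p /\ w X = theta v.
Proof.
move=> vL; have : (w @` [set X | proj (l := TM) X = p]) (theta v).
  by rewrite -weta; exists v.
by case=> X /= Xp wX; exists X.
Qed.

Lemma lifts_form_tangent (X : total TM) : exists2 v, v \in sval (eta (proj X)) & theta v = w X.
Proof.
have : (@theta R @` [set v | v \in sval (eta (proj X))]) (w X) by rewrite weta; exists X.
by case=> v vL E; exists v.
Qed.

(** For v in the line [eta p], u is proportional to theta(v). Hence [theta_sq k u] is proportional
    to v_k ^ 2 and [theta_prod u] to v_0 v_1 with the same factor, and their quotient is v_(1-k) /
    v_k. *)
Lemma lifts_form_coef p i (u : 'rV[K]_3) :
  (forall X, proj (l := TM) X = p -> w X = (tcoord (ltriv TM) i X : K) *: u) ->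
  forall k, (cdom1 k (eta p) <-> theta_sq k u != 0) /\
    (cdom1 k (eta p) -> cmap1 k (eta p) = theta_prod u / theta_sq k u).
Proof.
move=> uE k; have [v0 vL] := line_vpick (eta p); set v := vpick _ in v0 vL.
have [X [Xp wX]] := lifts_form_vec vL; rewrite uE // in wX.
have {X Xp}[c c0 {}wX] : exists2 c : K, c != 0 & c *: u = theta v.
  exists (tcoord (ltriv TM) i X) => //; apply: contraNneq v0 => c0.
  by apply/eqP/theta_eq0; rewrite -wX c0 scale0r.
have sq : v 0 k ^+ 2 = c * theta_sq k u by rewrite -theta_sqE -wX theta_sqZ.
have pr : v 0 0 * v 0 1 = c * theta_prod u.
  by rewrite -theta_prodE -wX /theta_prod mxE mulrA.
have dE : cdom1 k (eta p) <-> theta_sq k u != 0.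
  have -> : (theta_sq k u != 0) = (v 0 k != 0).
    by rewrite -(sqrf_eq0 (v 0 k)) sq (mulf_eq0 c) (negPf c0).
  exact: CP1_domE.
split=> // kp; have vk : v 0 k != 0 by apply/(CP1_domE k v0 vL).
have su := proj1 dE kp.
apply: (mulfI vk); rewrite -(CP1_mapE kp vL).
apply: (mulfI vk); apply: (mulfI su); apply: (mulfI c0).
have -> : v 0 k * v 0 (rev_ord k) = c * theta_prod u.
  have [r0 r1] : rev_ord (0 : 'I_2) = 1 /\ rev_ord (1 : 'I_2) = 0 by split; exact: val_inj.
  by rewrite -pr; move: (k); apply: ord2P; rewrite ?r0 ?r1 // mulrC.
have -> : v 0 k * (v 0 k * (theta_prod u / theta_sq k u)) = c * theta_prod u.
  by rewrite mulrA -expr2 sq -mulrA [theta_sq k u * _]mulrC divfK.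
by [].
Qed.

End Lifted.

(** Each y near the image of p has exactly one preimage in the chart. The universal form lets
    several local facts be combined; the existential one is the form used in the regularity
    predicates. *)
Lemma near_chartP i p (Q : M -> C -> Prop) : dom i p ->
  (\forall y \near (phi i p : C), forall x, dom i x -> phi i x = y -> Q x y) <->
  (\forall y \near (phi i p : C), exists x, [/\ dom i x, phi i x = y & Q x y]).
Proof.
move=> ip; split.
  move: (near_overlap ip ip); apply: filterS2 => y [x [ix _ xy]] /(_ x ix xy) Qx.
  by exists x.
apply: filterS => y [x [ix xy Qx]] x' ix' x'y.
by rewrite (surface_charts_injective ix' ix (etrans x'y (esym xy))).
Qed.

Lemma form_coef r w i j p : form10 r w -> dom i p -> dom j p ->
  exists u : C -> 'rV[K]_3, regular_at r u (phi i p) /\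
    \forall y \near (phi i p : C), forall x, dom i x -> phi i x = y ->
      dom j x /\ forall X, proj (l := TM) X = x -> w X = (tcoord (ltriv TM) j X : K) *: u y.
Proof.
move=> [wl wr] ip jp.
have /(linear_map_regularP _ (@surface_charts_injective _ M) (@tangent_coordinates _ M)) := wr.
case/(_ wl i j p ip jp) => u [ur uE]; exists u; split=> //; apply/(near_chartP _ ip).
by apply: filterS uE => y [x [? ? ? ?]]; exists x.
Qed.

(** By [lifts_form_coef] the coordinate of eta is a quotient of regular functions whose denominator
    is nonzero at p, hence nearby. *)
Lemma lifts_form_regular r w eta : form10 r w -> lifts_form w eta ->
  forall i k p, dom i p -> cdom1 k (eta p) ->
  regular_in_charts r (X := M') (Y := CP1_charted R) eta i k p.
Proof.
move=> wr weta i k p ip kp; have [u [ur uE]] := form_coef wr ip ip.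
have [_ uEp] := nbhs_singleton uE _ ip erefl.
have sq0 : theta_sq k (u (phi i p)) != 0.
  by apply/(proj1 (lifts_form_coef weta uEp k)).
have sqr := regular_at_theta_sq k ur.
exists (fun y => (u y 0 2 : C) * 2^-1 * (theta_sq k (u y))^-1); split.
  apply: regular_atM; last exact: regular_atV.
  by apply: regular_atM; [exact: regular_at_coord|exact: regular_at_cst].
have H : \forall y \near (phi i p : C), forall x, dom i x -> phi i x = y ->
    cdom1 k (eta x) /\ cmap1 k (eta x) = theta_prod (u y) / theta_sq k (u y).
  move: (near_neq0 (regular_at_continuous sqr) sq0) uE; apply: filterS2 => y y0 uE x ix xy.
  have [_ uEx] := uE x ix xy; have [d1 d2] := lifts_form_coef weta uEx k.
  by split; [apply/d1|apply/d2/d1].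
by move/(near_chartP _ ip): H; apply: filterS => y [x [? ? [? gy]]]; exists x; split=> //; exact: esym gy.
Qed.

(** * Trivializations by the components of beta *)

Section BetaTrivialization.
Variables (r : regularity) (S : lbundle C M') (beta : total S -> total taut) (eta : M -> CP1 R).

(** A description of beta free of trivializations, shared by pullback bundles and arbitrary
    spinors. *)
Definition fiberwise_bijective :=
  (forall e, proj (beta e) = eta (proj e)) /\
  forall p v, v \in sval (eta p) -> exists! e, proj e = p /\ taut_vec (beta e) = v.

Definition beta_triv : trivs C M' (total S) :=
  Trivs (fun k => eta @^-1` cdom1 k) (fun k e => taut_vec (beta e) 0 k).

Local Notation S' := (retriv beta_triv).

Hypothesis bb : fiberwise_bijective.

Lemma beta_vec_mem e : taut_vec (beta e) \in sval (eta (proj e)).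
Proof. by have := valP (beta e); rewrite -(proj1 bb). Qed.

Lemma beta_triv_coordinates : fiber_coordinates S'.
Proof.
move=> k p kp z; have [e [[ep ev] eu]] := proj2 bb p _ (chart_vec_mem z kp).
exists e; split; first by split; rewrite //= ev mxE chart_vec_at mulr1.
move=> e' /= [e'p e'z]; apply: eu; split=> //.
have e'L := beta_vec_mem e'; rewrite e'p in e'L.
by rewrite (chart_vecE kp e'L) e'z.
Qed.

Lemma beta_coordE e k l : cdom1 k (eta (proj e)) ->
  taut_vec (beta e) 0 l = chart_vec k (cmap1 k (eta (proj e))) 0 l * taut_vec (beta e) 0 k.
Proof.
by move=> kp; rewrite {1}(chart_vecE kp (beta_vec_mem e)) mxE mulrC.
Qed.

Lemma chart_vec_neq0 k l (L : CP1 R) : cdom1 k L -> cdom1 l L ->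
  chart_vec k (cmap1 k L) 0 l != 0.
Proof.
move=> kL lL; have cL : chart_vec k (cmap1 k L) \in sval L.
  by rewrite -[chart_vec _ _]scale1r; exact: chart_vec_mem.
apply/(@CP1_domE _ L _ l) => //.
by apply/eqP => /rowP/(_ k); rewrite chart_vec_at mxE => /eqP; rewrite oner_eq0.
Qed.

Lemma beta_triv_homogeneous_id : fiber_homogeneous 1 (E := S') (E' := S') id id.
Proof.
move=> p k l kp lp; exists (chart_vec k (cmap1 k (eta p)) 0 l).
split; first exact: chart_vec_neq0.
by move=> e ep /=; rewrite expr1 (beta_coordE l (k := k)) ep.
Qed.

(** In these trivializations beta preserves fibre coordinates, so its coefficients are by conversion
    those of the identity of [S']. *)
Lemma beta_triv_homogeneous : fiber_homogeneous 1 (E := S') (E' := taut) eta beta.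
Proof. exact: beta_triv_homogeneous_id. Qed.

Hypothesis eta_reg : forall i k p, dom i p -> cdom1 k (eta p) ->
  regular_in_charts r (X := M') (Y := CP1_charted R) eta i k p.

Lemma eta_coef i k p : dom i p -> cdom1 k (eta p) ->
  exists g : C -> C, regular_at r g (phi i p) /\
    \forall y \near (phi i p : C), forall x, dom i x -> phi i x = y ->
      cdom1 k (eta x) /\ cmap1 k (eta x) = g y.
Proof.
move=> ip kp; have [g [gr gE]] := eta_reg ip kp; exists g; split=> //.
by apply/(near_chartP _ ip); apply: filterS gE => y [x [? ? ? ?]]; exists x.
Qed.

Lemma beta_triv_coef_regular i k l p : dom i p -> cdom1 k (eta p) -> cdom1 l (eta p) ->
  coefficient_regular (E := S') (E' := S') r 1 id id i k l p.
Proof.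
move=> ip kp lp; have [g [gr gE]] := eta_coef ip kp; have [h [_ hE]] := eta_coef ip lp.
exists (fun y => chart_vec k (g y) 0 l); split.
  exact: regular_at_coord (regular_at_chart_vec k gr).
have H : \forall y \near (phi i p : C), forall x, dom i x -> phi i x = y ->
   [/\ cdom1 k (eta x), cdom1 l (eta x) & cmap1 k (eta x) = g y].
  by move: gE hE; apply: filterS2 => y gE hE x ix xy; have [? ?] := gE x ix xy; have [? ?] := hE x ix xy.
move/(near_chartP _ ip): H; apply: filterS => y [x [ix xy [kx lx gy]]]; exists x; split=> //.
by move=> e ex /=; rewrite expr1 (beta_coordE l (k := k)) ex ?gy.
Qed.

Lemma beta_triv_bundle : is_lbundle r (X := M') S'.
Proof.
have iM := @surface_charts_injective _ M; have cS := beta_triv_coordinates.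
split=> //; first by move=> p; exact: CP1_cover.
  exact: beta_triv_homogeneous_id.
split.
- move=> e; have [/(_ (proj e))[i ie] _ _] := rs_atlas M; have [k ke] := CP1_cover (eta (proj e)).
  by exists (i, k).
- move=> ij x y /set_mem ? /set_mem ?; exact: (total_space_injective iM cS).
- apply: (@bundle_map_regular _ _ _ M' M' S' S' r 1 id id) => //.
    by move=> i i' p ip i'p; exact: surface_id_regular.
  by move=> i k l p ip kp lp; exact: beta_triv_coef_regular.
Qed.

Lemma beta_triv_regular : regular_map r (X := total_space S') (Y := total_space taut) beta.
Proof.
have iM := @surface_charts_injective _ M; have cS := beta_triv_coordinates.
apply: (@bundle_map_regular _ _ _ M' _ S' taut r 1 eta beta) => //.
- exact: (proj1 bb).
- by move=> i k l p ip kp lp; exact: beta_triv_coef_regular.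
Qed.

End BetaTrivialization.

Lemma near_coef (Y : charted C) (E : lbundle C M') (E' : lbundle C Y) d (h : M' -> Y)
    (f : total E -> total E') i j j' p (a : C -> C) : dom i p ->
  (\forall y \near (phi i p : C), exists x,
    [/\ dom i x, tdom (ltriv E) j x, tdom (ltriv E') j' (h x), phi i x = y &
        forall e, proj e = x -> tcoord (ltriv E') j' (f e) = a y * tcoord (ltriv E) j e ^+ d]) ->
  \forall y \near (phi i p : C), forall x, dom i x -> phi i x = y ->
    [/\ tdom (ltriv E) j x, tdom (ltriv E') j' (h x) &
        forall e, proj e = x -> tcoord (ltriv E') j' (f e) = a y * tcoord (ltriv E) j e ^+ d].
Proof.
by move=> ip H; apply/(near_chartP _ ip); apply: filterS H => y [x [? ? ? ? ?]]; exists x.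
Qed.

(** In trivializations beta is multiplication by a nonzero b, so the only preimage of v has fibre
    coordinate v_k / b. *)
Lemma bundle_fiberwise_bijective (S : lbundle C M') (beta : total S -> total taut) eta :
  (forall p, exists j, tdom (ltriv S) j p) -> fiber_coordinates S ->
  (forall e, proj (beta e) = eta (proj e)) ->
  fiber_homogeneous 1 (E := S) (E' := taut) eta beta -> fiberwise_bijective beta eta.
Proof.
move=> cS fS bp bh; split=> // p v vL.
have [j jp] := cS p; have [k kp] := CP1_cover (eta p).
have [b [b0 bE]] := bh p j k jp kp.
have [e [ep ez]] := fiber_coordP fS jp (v 0 k / b).
have vE e' : proj e' = p -> taut_vec (beta e') =
    (b * tcoord (ltriv S) j e') *: chart_vec k (cmap1 k (eta p)).
  move=> e'p; have vL' : taut_vec (beta e') \in sval (proj (beta e')) by exact: (valP (beta e')).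
  rewrite bp e'p in vL'; rewrite {1}(chart_vecE kp vL'); congr (_ *: _).
  by have := bE e' e'p; rewrite expr1.
exists e; split; first by rewrite vE // ez mulrC divfK // -chart_vecE.
move=> e' [e'p e'v]; apply: (fiber_coord_inj fS jp) => //; apply: (mulfI b0).
by rewrite ez mulrC divfK // -e'v vE // mxE chart_vec_at mulr1.
Qed.

(** * Square maps q related to a form by w (q e) = theta (beta e) *)

Section Squares.
Variables (S : lbundle C M') (q : total S -> total TM) (beta : total S -> total taut).
Variables (eta : M -> CP1 R) (w : vform M).
Hypotheses (qp : forall e, proj (q e) = proj e)
  (wq : forall e, w (q e) = theta (taut_vec (beta e))).

(** Apply the linear functional [theta_sq k] to w (q e) = theta (beta e) and divide by its value on
    u. *)
Lemma square_coordE p j k (u : 'rV[K]_3) e : theta_sq k u != 0 ->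
  (forall X, proj (l := TM) X = p -> w X = (tcoord (ltriv TM) j X : K) *: u) ->
  proj e = p -> tcoord (ltriv TM) j (q e) = (theta_sq k u)^-1 * taut_vec (beta e) 0 k ^+ 2.
Proof.
move=> u0 uE ep; rewrite -theta_sqE -wq uE ?qp // theta_sqZ mulrC mulfK //.
Qed.

Lemma square_homogeneous : nonzero_null_form w -> lifts_form w eta ->
  fiber_homogeneous 2 (E := retriv (beta_triv beta eta)) (E' := TM) id q.
Proof.
move=> wn weta p k j kp jp; have [u [u0 _ uE]] := wn p j jp.
have sq0 : theta_sq k u != 0 by apply/(proj1 (lifts_form_coef weta uE k)).
exists (theta_sq k u)^-1; split; first by rewrite invr_eq0.
by move=> e ep; exact: (square_coordE sq0 uE ep).
Qed.

Lemma square_regular r : fiberwise_bijective beta eta -> form10 r w -> lifts_form w eta ->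
  regular_map r (X := total_space (retriv (beta_triv beta eta))) (Y := total_space TM) q.
Proof.
move=> bb wr weta; have iM := @surface_charts_injective _ M.
have cS := beta_triv_coordinates bb.
apply: (@bundle_map_regular _ _ _ M' M' (retriv (beta_triv beta eta)) TM r 2 id q) => //.
  by move=> i i' p ip i'p; exact: surface_id_regular.
move=> i k j p ip kp jp; have [u [ur uE]] := form_coef wr ip jp.
have [_ uEp] := nbhs_singleton uE _ ip erefl.
have sq0 : theta_sq k (u (phi i p)) != 0.
  by apply/(proj1 (lifts_form_coef weta uEp k)).
have sqr := regular_at_theta_sq k ur.
exists (fun y => (theta_sq k (u y))^-1); split; first exact: regular_atV.
have H : \forall y \near (phi i p : C), forall x, dom i x -> phi i x = y ->
    [/\ dom j x, cdom1 k (eta x) & forall e, proj e = x ->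
    tcoord (ltriv TM) j (q e) = (theta_sq k (u y))^-1 * taut_vec (beta e) 0 k ^+ 2].
  move: (near_neq0 (regular_at_continuous sqr) sq0) uE; apply: filterS2 => y y0 uE x ix xy.
  have [jx uEx] := uE x ix xy; have [d1 d2] := lifts_form_coef weta uEx k.
  by split=> [||e]; [|exact/d1|exact: square_coordE].
by move/(near_chartP _ ip): H; apply: filterS => y [x [? ? [? ? ?]]]; exists x.
Qed.

Hypotheses (qs : forall X, exists e, q e = X).

Lemma square_lifts : fiberwise_bijective beta eta -> lifts_form w eta.
Proof.
move=> bb p; apply/seteqP; split=> [_ [v /= vL <-]|_ [X /= Xp <-]].
  have [e [[ep ev] _]] := proj2 bb p v vL.
  by exists (q e); [exact: etrans (qp e) ep|rewrite wq ev].
have [e eX] := qs X; exists (taut_vec (beta e)); last by rewrite -wq eX.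
have ep : proj e = p by rewrite -qp eX.
by have := beta_vec_mem bb e; rewrite ep.
Qed.

Lemma square_null X : \sum_(k < 3) w X 0 k ^+ 2 = 0.
Proof. by have [e <-] := qs X; rewrite wq theta_null. Qed.

Lemma square_nonzero p : fiberwise_bijective beta eta -> exists X, proj X = p /\ w X != 0.
Proof.
move=> bb; have [v0 vL] := line_vpick (eta p).
have [e [[ep ev] _]] := proj2 bb p _ vL; exists (q e); rewrite qp; split=> //.
by rewrite wq ev; apply: contraNneq v0 => /theta_eq0 ->.
Qed.

Hypotheses (cS : forall p, exists j, tdom (ltriv S) j p) (fS : fiber_coordinates S)
  (qh : fiber_homogeneous 2 (E := S) (E' := TM) id q)
  (bp : forall e, proj (beta e) = eta (proj e))
  (bh : fiber_homogeneous 1 (E := S) (E' := taut) eta beta).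

(** If e has coordinate z, then q e has coordinate a z ^ 2 and theta (beta e) is (b z) ^ 2 times the
    theta of the frame; eliminating z ^ 2 leaves b ^ 2 / a. *)
Lemma square_form_coordE p j k m (a b : C) :
  tdom (ltriv S) j p -> dom m p -> cdom1 k (eta p) ->
  (forall e, proj e = p -> tcoord (ltriv TM) m (q e) = a * tcoord (ltriv S) j e ^+ 2) ->
  (forall e, proj e = p -> taut_vec (beta e) 0 k = b * tcoord (ltriv S) j e ^+ 1) ->
  forall X, proj X = p ->
  w X = (tcoord (ltriv TM) m X : K) *: ((b ^+ 2 / a) *: theta (chart_vec k (cmap1 k (eta p)))).
Proof.
move=> jp mp kp aE bE X Xp; have [e eX] := qs X.
have ep : proj e = p by rewrite -qp eX.
have a0 : a != 0 := coefficient_neq0 fS qh jp mp aE.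
have vL := beta_vec_mem (bundle_fiberwise_bijective cS fS bp bh) e.
rewrite ep in vL.
rewrite -eX wq (theta_chart kp vL) scalerA; congr (_ *: _).
by rewrite aE // bE // expr1; field.
Qed.

(** Stated for any r and any trivializations, so that it serves both the smooth structure of a
    spinor and a holomorphic structure on it. *)
Lemma square_form10 r :
  regular_map r (X := total_space S) (Y := total_space TM) q ->
  regular_map r (X := total_space S) (Y := total_space taut) beta -> form10 r w.
Proof.
move=> qr br; have iM := @surface_charts_injective _ M.
have lin p i : dom i p -> exists u : 'rV[K]_3, forall X, proj (l := TM) X = p ->
    w X = (tcoord (ltriv TM) i X : K) *: u.
  move=> ip; have [j jp] := cS p; have [k kp] := CP1_cover (eta p).
  have [a [_ aE]] := qh jp ip; have [b [_ bE]] := bh jp kp.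
  by eexists; exact: square_form_coordE jp ip kp aE bE.
split=> //.
apply/(linear_map_regularP _ (@surface_charts_injective _ M) (@tangent_coordinates _ M)) => //.
move=> i m p ip mp; have [j jp] := cS p; have [k kp] := CP1_cover (eta p).
have [_ [a [ar /(near_coef ip) aE]]] := bundle_map_regularP iM fS qp qh qr ip jp mp mp.
have [[g [gr gE]] [b [bR /(near_coef ip) bE]]] := bundle_map_regularP iM fS bp bh br ip jp kp kp.
have {}gE : \forall y \near (phi i p : C), forall x, dom i x -> phi i x = y ->
    cdom1 k (eta x) /\ g y = cmap1 k (eta x).
  by apply/(near_chartP _ ip); apply: filterS gE => y [x [? ? ? ?]]; exists x.
have a0 : a (phi i p) != 0.
  have [_ _ aEp] := nbhs_singleton aE _ ip erefl; exact: (coefficient_neq0 fS qh jp mp aEp).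
exists (fun y => (b y ^+ 2 * (a y)^-1) *: theta (chart_vec k (g y))); split.
  apply: regular_atZ; first by apply: regular_atM; [exact: regular_atX|exact: regular_atV].
  exact: regular_at_theta (regular_at_chart_vec k gr).
have H : \forall y \near (phi i p : C), forall x, dom i x -> phi i x = y ->
    dom m x /\ forall X, proj (l := TM) X = x ->
      w X = (tcoord (ltriv TM) m X : K) *: ((b y ^+ 2 * (a y)^-1) *: theta (chart_vec k (g y))).
  move: aE bE gE; apply: filterS3 => y aE bE gE x ix xy.
  have [jx mx aEx] := aE x ix xy; have [_ kx bEx] := bE x ix xy; have [_ ->] := gE x ix xy.
  by split=> //; exact: (square_form_coordE jx mx kx aEx bEx).
by move/(near_chartP _ ip): H; apply: filterS => y [x [? ? [? ?]]]; exists x.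
Qed.

End Squares.

(** If beta and beta' have coefficients b and b', then beta' o f = beta forces f to have coefficient
    b / b', which is regular as b' is nonzero. *)
Lemma bundle_iso_of_beta r (S S' : lbundle C M') (beta : total S -> total taut)
    (beta' : total S' -> total taut) eta (f : total S -> total S') :
  (forall p, exists j, tdom (ltriv S) j p) -> fiber_coordinates S ->
  fiber_coordinates S' ->
  (forall e, proj (beta e) = eta (proj e)) -> (forall e, proj (beta' e) = eta (proj e)) ->
  fiber_homogeneous 1 (E := S) (E' := taut) eta beta ->
  fiber_homogeneous 1 (E := S') (E' := taut) eta beta' ->
  regular_map r (X := total_space S) (Y := total_space taut) beta ->
  regular_map r (X := total_space S') (Y := total_space taut) beta' ->
  (forall e, proj (f e) = proj e) -> (forall e, beta' (f e) = beta e) ->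
  fiber_homogeneous 1 (E := S) (E' := S') id f /\
  regular_map r (X := total_space S) (Y := total_space S') f.
Proof.
move=> cS fS fS' bp bp' bh bh' br br' fp fb; have iM := @surface_charts_injective _ M.
split.
  move=> p j j' jp j'p; have [k kp] := CP1_cover (eta p).
  have [b [b0 bE]] := bh p j k jp kp; have [b' [b'0 b'E]] := bh' p j' k j'p kp.
  exists (b / b'); split=> [|e ep]; first by rewrite mulf_neq0 // invr_eq0.
  apply: (mulfI b'0); have := b'E (f e); rewrite fp fb expr1 => <- //.
  by rewrite bE // !expr1 mulrA [b' * _]mulrC divfK.
apply: (@bundle_map_regular _ _ _ M' M' S S' r 1 id f) => //.
  by move=> i i' p ip i'p; exact: surface_id_regular.
move=> i j j' p ip jp j'p; have [k kp] := CP1_cover (eta p).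
have [_ [b [bR /(near_coef ip) bE]]] := bundle_map_regularP iM fS bp bh br ip jp kp kp.
have [_ [b' [bR' /(near_coef ip) bE']]] := bundle_map_regularP iM fS' bp' bh' br' ip j'p kp kp.
have b0 : b' (phi i p) != 0.
  have [_ _ bEp] := nbhs_singleton bE' _ ip erefl; exact: (coefficient_neq0 fS' bh' j'p kp bEp).
exists (fun y => b y * (b' y)^-1); split; first by apply: regular_atM => //; exact: regular_atV.
have H : \forall y \near (phi i p : C), forall x, dom i x -> phi i x = y ->
    [/\ tdom (ltriv S) j x, tdom (ltriv S') j' x & forall e, proj e = x ->
      tcoord (ltriv S') j' (f e) = b y * (b' y)^-1 * tcoord (ltriv S) j e ^+ 1].
  move: bE bE'; apply: filterS2 => y bE bE' x ix xy.
  have [jx kx bEx] := bE x ix xy; have [j'x _ bEx'] := bE' x ix xy; split=> // e ep.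
  have b'0 : b' y != 0 := coefficient_neq0 fS' bh' j'x kx bEx'.
  apply: (mulfI b'0); have := bEx' (f e); rewrite fp fb expr1 => <- //.
  by rewrite bEx // !expr1 mulrA [b' y * _]mulrC divfK.
by move/(near_chartP _ ip): H; apply: filterS => y [x [? ? [? ? ?]]]; exists x.
Qed.

(** * Equivalence of spinors from set-level data *)

Lemma spinor_fiberwise_bijective (s : spinor_data M) : spinor s ->
  fiberwise_bijective (@sp_beta _ _ s) (sp_eta s).
Proof.
case=> -[[cS fS _ _] _ _ _ _] _ _ bp bh; exact: (bundle_fiberwise_bijective cS fS bp bh).
Qed.

(** Smoothness and linearity of the bijection and of its inverse are automatic, by
    [bundle_iso_of_beta] in both directions. *)
Lemma spinor_equiv_of_bijection (s t : spinor_data M)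
    (alpha : total (sp_bundle s) -> total (sp_bundle t)) g : spinor s -> spinor t ->
  cancel alpha g -> cancel g alpha ->
  (forall e, sp_square (s := t) (alpha e) = sp_square (s := s) e) ->
  (forall e, sp_beta (s := t) (alpha e) = sp_beta (s := s) e) -> spinor_equiv s t.
Proof.
move=> hs ht ag ga qa ba.
have [_ sbb] := spinor_fiberwise_bijective hs.
case: hs ht => -[[cS fS _ _] qp _ _ _] _ br bp bh [[[cS' fS' _ _] qp' _ _ _] _ br' bp' bh'].
have ap e : proj (alpha e) = proj e by rewrite -qp' qa qp.
have gp e : proj (g e) = proj e by rewrite -{2}(ga e) ap.
have bg e : sp_beta (s := s) (g e) = sp_beta (s := t) e by rewrite -ba ga.
(* Every fibre is inhabited, and beta of any vector over p lies over the value of both base maps at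
   p. *)
have etaE : sp_eta t = sp_eta s.
  apply/funext => p; have [j jp] := cS p; have [e [<- _]] := fiber_coordP fS jp 1.
  by rewrite -bp -ba bp' ap.
rewrite etaE in bp' bh'.
have [ah ar] := bundle_iso_of_beta cS fS fS' bp bp' bh bh' br br' ap ba.
have [gh gr] := bundle_iso_of_beta cS' fS' fS bp' bp bh' bh br' br gp bg.
by exists alpha; split=> //; split=> //; exists g.
Qed.

Lemma fiber_matching (S S' : lbundle C M') (beta : total S -> total taut)
    (beta' : total S' -> total taut) eta :
  fiberwise_bijective beta eta -> fiberwise_bijective beta' eta ->
  exists f : total S -> total S', forall e, proj (f e) = proj e /\ beta' (f e) = beta e.
Proof.
move=> bb bb'.
have /choice[f fP] : forall e, exists e' : total S', proj e' = proj e /\ beta' e' = beta e.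
  move=> e; have [e' [[e'p e'v] _]] := proj2 bb' _ _ (beta_vec_mem bb e).
  exists e'; split=> //; apply: eq_taut => //.
  by rewrite (proj1 bb) (proj1 bb') e'p.
by exists f.
Qed.

(** Both base maps lift w and so coincide; vectors with equal beta are then matched. Matched vectors
    have equal squares because w takes the same value on both and is injective on tangent spaces. *)
Lemma spinor_equiv_of_form w (s t : spinor_data M) : nonzero_null_form w -> spinor s -> spinor t ->
  (forall e, w (sp_square (s := s) e) = theta (taut_vec (sp_beta e))) ->
  (forall e, w (sp_square (s := t) e) = theta (taut_vec (sp_beta e))) ->
  spinor_equiv s t.
Proof.
move=> wn hs ht ws wt.
have bs := spinor_fiberwise_bijective hs; have bt := spinor_fiberwise_bijective ht.
have [[_ qp _ qs _] _ _ _ _] := hs; have [[_ qp' _ qs' _] _ _ _ _] := ht.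
have etaE : sp_eta t = sp_eta s.
  exact: lifts_form_unique (square_lifts qp' wt qs' bt) (square_lifts qp ws qs bs).
rewrite etaE in bt.
have [f fP] := fiber_matching bs bt; have [g gP] := fiber_matching bt bs.
have inj (S : lbundle C M') (beta : total S -> total taut) eta e e' :
    fiberwise_bijective beta eta -> proj e = proj e' -> beta e = beta e' -> e = e'.
  move=> bb pe be; have [e0 [_ u]] := proj2 bb _ _ (beta_vec_mem bb e').
  by rewrite -(u e) ?pe ?be // (u e').
apply: (@spinor_equiv_of_bijection s t f g) => //.
- move=> e; have [fp fb] := fP e; have [gp gb] := gP (f e).
  by apply: (inj _ _ _ _ _ bs); rewrite ?gp ?gb.
- move=> e; have [gp gb] := gP e; have [fp fb] := fP (g e).
  by apply: (inj _ _ _ _ _ bt); rewrite ?fp ?fb.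
- move=> e; have [fp fb] := fP e.
  by apply: (nonzero_null_inj (p := proj e) wn); rewrite ?qp ?qp' // ws wt fb.
- by move=> e; have [] := fP e.
Qed.

Lemma sqrt_squareP w : weierstrass w -> forall s,
  proj (sqrt_square (w := w) s) = proj s /\
  w (sqrt_square s) = theta (taut_vec (sval s).2).
Proof.
move=> hw s; have weta := gauss_map_lifts (weierstrass_nonzero_null hw).
have vL : taut_vec (sval s).2 \in sval (gauss_map w (proj s)).
  have E : gauss_map w (proj s) = proj (sval s).2 by exact: (proj2_sig s).
  by rewrite E; exact: (valP (sval s).2).
have [X XP] := lifts_form_vec weta vL.
(* The set is inhabited, so the default zero vector is never the value. *)
by rewrite /sqrt_square; case: xgetP => [Y ->//|/(_ X)].
Qed.

Lemma pullback_fiberwise_bijective (eta : M -> CP1 R) :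
  fiberwise_bijective (S := pullback eta taut) (fun s => (sval s).2) eta.
Proof.
split=> [[[p e] pe] //=|p v vL].
pose e : total taut := exist (fun e : CP1 R * 'rV[K]_2 => e.2 \in sval e.1) (eta p, v) vL.
exists (exist (fun x : M * total taut => eta x.1 = proj x.2) (p, e) erefl); split=> // -[[p' e'] /= pe'] [/= pp' ve'].
apply/eq_exist => /=; congr pair => //.
apply: eq_taut; [exact: etrans (congr1 eta (esym pp')) pe'|exact: esym ve'].
Qed.

Lemma spinor_of_weierstrassP w : weierstrass w -> spinor (spinor_of_weierstrass w).
Proof.
move=> hw; have wn := weierstrass_nonzero_null hw; have weta := gauss_map_lifts wn.
have bb := pullback_fiberwise_bijective (gauss_map w).
have [wf _ _] := hw; have er := lifts_form_regular wf weta.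
have qp s := proj1 (sqrt_squareP hw s); have wq s := proj2 (sqrt_squareP hw s).
split.
- split.
  (* The trivializations of the pullback bundle are by conversion those of [beta_triv] for its
     canonical beta. *)
  + exact: (beta_triv_bundle bb er).
  + exact: qp.
  + exact: (square_homogeneous (S := pullback (gauss_map w) taut) qp wq wn weta).
  + move=> X; have [v vL vX] := lifts_form_tangent weta X.
    have [e [[ep ev] _]] := proj2 bb _ _ vL; exists e.
    by apply: (nonzero_null_inj (p := proj X) wn); rewrite ?qp // wq ev vX.
  + exact: (square_regular (S := pullback (gauss_map w) taut) qp wq bb wf weta).
- by apply/(regular_mapP _ _ (@surface_charts_injective _ M)) => i k p; exact: er.
- exact: (beta_triv_regular bb er).
- exact: (proj1 bb).
- exact: (beta_triv_homogeneous bb).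
Qed.

(** The form is defined through a set-theoretic section g of the square map. Vectors with the same
    square have fibre coordinates with the same z ^ 2, and theta (beta e) depends only on z ^ 2. *)
Lemma spinor_form (s : spinor_data M) : spinor s ->
  exists w, forall e, w (sp_square (s := s) e) = theta (taut_vec (sp_beta e)).
Proof.
move=> hs; have bb := spinor_fiberwise_bijective hs.
have [[[cS fS _ _] qp qh qs _] _ _ bp bh] := hs.
have /choice[g gE] := qs.
exists (fun X => theta (taut_vec (sp_beta (g X)))) => e.
set e' := g _; have qe : sp_square e' = sp_square e by exact: gE.
have pe : proj e' = proj e by rewrite -qp qe qp.
have [j jp] := cS (proj e); have [k kp] := CP1_cover (sp_eta s (proj e)).
have [/(_ (proj e))[i ip] _ _] := rs_atlas M.
have [a [a0 aE]] := qh _ j i jp ip; have [b [_ bE]] := bh _ j k jp kp.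
have z2 : tcoord (ltriv (sp_bundle s)) j e' ^+ 2 = tcoord (ltriv (sp_bundle s)) j e ^+ 2.
  by apply: (mulfI a0); rewrite -aE // -aE // qe.
have vE d : proj d = proj e -> theta (taut_vec (sp_beta d)) =
    ((b ^+ 2 * tcoord (ltriv (sp_bundle s)) j d ^+ 2 : C) : K) *:
      theta (chart_vec k (cmap1 k (sp_eta s (proj e)))).
  move=> dp; have vL := beta_vec_mem bb d; rewrite dp in vL.
  rewrite (theta_chart kp vL); congr (_ *: _).
  have := bE d dp; rewrite expr1 => vk; rewrite -exprMn; congr (_ ^+ 2); exact: vk.
by rewrite vE // vE // z2.
Qed.

Lemma spinor_form_weierstrass w (s : spinor_data M) : spinor s ->
  (forall e, w (sp_square (s := s) e) = theta (taut_vec (sp_beta e))) -> weierstrass w.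
Proof.
move=> hs wq; have bb := spinor_fiberwise_bijective hs.
have [[[cS fS _ _] qp qh qs qr] _ br bp bh] := hs.
split.
- exact: (square_form10 qp wq qs cS fS qh bp bh qr br).
- by move=> p; exact: (square_nonzero qp wq p bb).
- by move=> X; exact: (square_null wq qs X).
Qed.

Lemma spinor_equiv_form w (s : spinor_data M) : weierstrass w ->
  spinor_equiv (spinor_of_weierstrass w) s ->
  forall e, w (sp_square (s := s) e) = theta (taut_vec (sp_beta e)).
Proof.
move=> hw [alpha [[_ _ _ [g [_ ga _]]] qa ba]] e.
by rewrite -(ga e) qa ba; exact: (proj2 (sqrt_squareP hw (g e))).
Qed.

(** If passing to [T] multiplies the fibre coordinate by c, the coefficient of f becomes a / c ^
    d. *)
Lemma homogeneous_retriv (Y : charted C) d (S : lbundle C M') (T : trivs C M' (total S))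
    (E : lbundle C Y) (h : M' -> Y) (f : total S -> total E) :
  (forall p, exists j, tdom (ltriv S) j p) ->
  fiber_homogeneous 1 (E := S) (E' := retriv T) id id ->
  fiber_homogeneous d (E := S) (E' := E) h f ->
  fiber_homogeneous d (E := retriv T) (E' := E) h f.
Proof.
move=> cS hT hf p k l kp lp; have [j jp] := cS p.
have [c [c0 cE]] := hT p j k jp kp; have [a [a0 aE]] := hf p j l jp lp.
exists (a / c ^+ d); split=> [|e ep]; first by rewrite mulf_neq0 // invr_eq0 expf_neq0.
have := cE e ep; rewrite expr1 => ->.
by rewrite (aE e ep) exprMn mulrA divfK ?expf_neq0.
Qed.

Lemma holomorphic_equiv w (s : spinor_data M) : weierstrass w -> spinor s ->
  spinor_equiv (spinor_of_weierstrass w) s ->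
  (holomorphic_weierstrass w <-> holomorphic_spinor s).
Proof.
move=> hw hs /(spinor_equiv_form hw) wq; have bb := spinor_fiberwise_bijective hs.
have [[[cS fS _ _] qp qh qs qr] _ br bp bh] := hs.
have wn := weierstrass_nonzero_null hw; have weta := square_lifts qp wq qs bb.
split=> [[_ wf]|[_ [T [[[cT fT _ _] [_ hT _ _]] qT bT]]]].
  (* For holomorphic w the components of beta are the fibre coordinates of the required holomorphic
     structure. *)
  split=> //; exists (beta_triv (@sp_beta _ _ s) (sp_eta s)).
  have er := lifts_form_regular wf weta; have [ws _ _] := hw.
  (* The smooth version serves to compare with the given structure: beta is smooth for both sets of
     trivializations, so the identity is a smooth isomorphism between them. *)
  have er' := lifts_form_regular ws weta.
  split; [split; first exact: beta_triv_bundle|exact: square_regular|exact: beta_triv_regular].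
  have fS' := beta_triv_coordinates bb.
  have bt := beta_triv_regular bb er'.
  have bht := beta_triv_homogeneous bb.
  have cS' p : exists j, tdom (ltriv (retriv (beta_triv (@sp_beta _ _ s) (sp_eta s)))) j p.
    exact: CP1_cover.
  set S' := retriv _ in fS' bt bht cS'.
  have [ih ir] := bundle_iso_of_beta (S := sp_bundle s) (S' := S') (f := id) cS fS fS' bp bp bh bht br bt (fun=> erefl) (fun=> erefl).
  have [_ ir'] := bundle_iso_of_beta (S := S') (S' := sp_bundle s) (f := id) cS' fS' fS bp bp bht bh bt br (fun=> erefl) (fun=> erefl).
  by split=> //; exists id.
split=> //.
(* Conversely the formula for w in terms of q and beta is read in the trivializations [T], where
   both maps are holomorphic. *)
exact: (square_form10 (S := retriv T) qp wq qs cT fT (homogeneous_retriv cS hT qh) bp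
  (homogeneous_retriv cS hT bh) qT bT).
Qed.


End Correspondence.

(* The first two clauses say that spinor_equiv is an equivalence relation on
   spinor representations and that the map is well defined; the next two are
   injectivity and surjectivity onto the set of equivalence classes. *)
Theorem mainTheorem4 (R : realType) (M : riemann_surface R) :
  [/\ forall s : spinor_data M, spinor s -> spinor_equiv s s,
      forall s t : spinor_data M, spinor s -> spinor t ->
        spinor_equiv s t -> spinor_equiv t s &
      forall s t u : spinor_data M, spinor s -> spinor t -> spinor u ->
        spinor_equiv s t -> spinor_equiv t u -> spinor_equiv s u] /\
  [/\ forall w : vform M, weierstrass w -> spinor (spinor_of_weierstrass w),
      forall w1 w2 : vform M, weierstrass w1 -> weierstrass w2 ->
        spinor_equiv (spinor_of_weierstrass w1) (spinor_of_weierstrass w2) ->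
        w1 = w2,
      forall s : spinor_data M, spinor s ->
        exists w : vform M,
          weierstrass w /\ spinor_equiv (spinor_of_weierstrass w) s &
      forall (w : vform M) (s : spinor_data M), weierstrass w -> spinor s ->
        spinor_equiv (spinor_of_weierstrass w) s ->
        (holomorphic_weierstrass w <-> holomorphic_spinor s)].
Proof.
split; split.
- by move=> s hs; exact: (spinor_equiv_of_bijection (g := id) hs hs).
- move=> s t hs ht [alpha [[_ _ _ [g [ag ga _]]] qa ba]].
  by apply: (spinor_equiv_of_bijection (alpha := g) (g := alpha) ht hs) => // e;
    rewrite -?qa -?ba ga.
- move=> s t u hs _ hu [f [[_ _ _ [f' [ff' f'f _]]] qf bf]].
  move=> [h [[_ _ _ [h' [hh' h'h _]]] qh bh]].
  apply: (spinor_equiv_of_bijection (alpha := h \o f) (g := f' \o h') hs hu).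
  + exact: can_comp.
  + exact: can_comp.
  + by move=> e /=; rewrite qh qf.
  + by move=> e /=; rewrite bh bf.
- exact: spinor_of_weierstrassP.
(* Every X is the square of some e in the spinor of [w2], and both forms take the value theta (beta
   e) there. *)
- move=> w1 w2 hw1 hw2 h; apply/funext => X.
  have [[_ _ _ qs _] _ _ _ _] := spinor_of_weierstrassP hw2; have [e <-] := qs X.
  by rewrite (spinor_equiv_form hw1 h); exact: esym (proj2 (sqrt_squareP hw2 e)).
- move=> s hs; have [w wq] := spinor_form hs; have hw := spinor_form_weierstrass hs wq.
  exists w; split=> //.
  have hws := spinor_of_weierstrassP hw.
  apply: (spinor_equiv_of_form (weierstrass_nonzero_null hw) hws hs) => // e.
  exact: (proj2 (sqrt_squareP hw e)).
- by move=> w s; exact: holomorphic_equiv.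
Qed.
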